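(* Let $\mathcal{L}:\mathbb{R}^d\to\mathbb{R}$ attain its minimum, put $\mathcal{L}_*:=\min\mathcal{L}$, and suppose there are constants $\ell_1,\ell_2,\ell_3>0$ and a non-negative continuous function $H:\mathbb{R}_+\to\mathbb{R}_+$ such that for all $w\in\mathbb{R}^d$ $$\mathcal{L}(w)-\mathcal{L}_*\le\frac{1}{\ell_1}\|\nabla\mathcal{L}(w)\|^2,\qquad|\Delta\mathcal{L}(w)|\le\ell_2(\mathcal{L}(w)-\mathcal{L}_* )+\ell_3,\qquad\|\nabla\mathcal{L}(w)\|\le H(\mathcal{L}(w)-\mathcal{L}_* ).$$ Let $\sigma>0$ be such that $\ell_1>\sigma\ell_2$, and let $w_t$ be a solution of the Langevin dynamics $dw_t=-\nabla\mathcal{L}(w_t)\,dt+\sqrt{2\sigma}\,dB_t$. Then $$\mathbb{E}[\mathcal{L}(w_t)-\mathcal{L}_*]\le\mathbb{E}[\mathcal{L}(w_0)-\mathcal{L}_*]\,e^{-(\ell_1-\sigma\ell_2)t}+\sigma\ell_3\,\frac{1-e^{-(\ell_1-\sigma\ell_2)t}}{\ell_1-\sigma\ell_2},$$ which implies, for a constant $C$, $$\mathbb{E}[\mathcal{L}(w_t)-\mathcal{L}_*]\le C\,\frac{\sigma\ell_3}{\ell_1-\sigma\ell_2}$$ for $t>0$ large enough.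
   Context: $B_t$ is a $d$-dimensional Brownian motion; the initial point $w_0\in\mathbb{R}^d$ is given or drawn from an initial probability measure $\rho_0$ on $\mathbb{R}^d$. It is a standing assumption that the Langevin dynamics has a unique strong solution.
   Formalization: The large-time bound is stated under the extra assumption that E[L(w_0)-L_*] is finite (it fails otherwise, e.g. L(w)=|w|²/2 with infinite second moment of w_0), and L is taken to be twice continuously differentiable, as the gradient and Laplacian suggest. *)

(* Defs.v *)
From HB Require Import structures.
From mathcomp Require Import all_boot all_order all_algebra.
From mathcomp Require Import all_classical all_reals all_analysis.

Set Implicit Arguments.
Unset Strict Implicit.
Unset Printing Implicit Defensive.

Import Order.TTheory GRing.Theory Num.Theory.
Import numFieldNormedType.Exports.

Local Open Scope classical_set_scope.
Local Open Scope ring_scope.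

Section calculus.
Context {R : realType} {d : nat}.
Implicit Types (f : 'rV[R]_d -> R) (i j : 'I_d) (x v : 'rV[R]_d).

(* The library norm on ['rV[R]_d] is the sup norm. *)
Definition enorm v : R := Num.sqrt (\sum_(i < d) v ord0 i ^+ 2).

Definition partial f i : 'rV[R]_d -> R := 'D_(delta_mx ord0 i) f.

Definition grad f x : 'rV[R]_d := \row_(i < d) partial f i x.

Definition laplacian f x : R := \sum_(i < d) partial (partial f i) i x.

(* [derive] is a total function, so the existence of the partial derivatives
   has to be required explicitly. *)
Definition C1 f : Prop :=
  [/\ continuous f,
      forall i x, derivable f x (delta_mx ord0 i) &
      forall i, continuous (partial f i)].

Definition C2 f : Prop := C1 f /\ forall i, C1 (partial f i).

Definition is_minimum f (m : R) : Prop :=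
  (exists x, f x = m) /\ forall x, m <= f x.

End calculus.

(* Processes are indexed by [R]; only the times [0 <= t] are meaningful, and
   every condition below is restricted to them. *)
Section langevin.
Context {R : realType} {disp : measure_display} {T : measurableType disp}.
Context {d : nat}.
Variable P : probability T R.
Implicit Types (F : R -> set (set T)) (B w : R -> T -> 'rV[R]_d).

Definition filtration F : Prop :=
  [/\ forall t : R, 0 <= t -> sigma_algebra setT (F t),
      forall t : R, 0 <= t -> F t `<=` measurable &
      forall s t : R, 0 <= s -> s <= t -> F s `<=` F t].

Definition adapted F w : Prop :=
  forall t : R, 0 <= t -> forall (i : 'I_d) (U : set R), measurable U ->
    F t ((fun omega => w t omega ord0 i) @^-1` U).

Definition ae_continuous_paths w : Prop :=
  {ae P, forall omega, {within `[0, +oo[, continuous (fun t => w t omega)}}.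

(* The last clause says at once that, for [s < t], the increment
   [B t - B s] is independent of [F s] and has law [N(0, (t - s) I_d)]:
   rectangles form a pi-system generating the Borel sets of [R^d].  The last
   argument of [normal_prob] is the standard deviation. *)
Definition brownian_motion F B : Prop :=
  [/\ adapted F B,
      {ae P, forall omega, B 0 omega = 0},
      ae_continuous_paths B &
      forall s t : R, 0 <= s -> s < t ->
      forall (A : set T) (U : 'I_d -> set R),
        F s A -> (forall i, measurable (U i)) ->
        P (A `&` [set omega | forall i,
                    U i (B t omega ord0 i - B s omega ord0 i)]) =
        (P A * \prod_(i < d) normal_prob 0 (Num.sqrt (t - s)) (U i))%E].

(* Solution of [dw_t = - grad L (w_t) dt + sqrt (2 sigma) dB_t].  The noise
   coefficient is constant, so the stochastic integral in the integral form
   of the equation is [sqrt (2 sigma) B_t] ([B_0 = 0]).  The initial value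
   [w 0] is an [F 0]-measurable random vector of arbitrary law, hence
   independent of [B]; a deterministic [w 0] is a special case. *)
Definition langevin_solution F B (L : 'rV[R]_d -> R) (sigma : R) w : Prop :=
  [/\ adapted F w,
      ae_continuous_paths w &
      {ae P, forall omega, forall t : R, 0 <= t ->
        w t omega = w 0 omega
          - \row_(i < d) \int[lebesgue_measure]_(s in `[0, t])
                           (grad L (w s omega) ord0 i)
          + Num.sqrt (2 * sigma) *: B t omega}].

Definition unique_langevin_solution F B (L : 'rV[R]_d -> R) (sigma : R) w :
    Prop :=
  langevin_solution F B L sigma w /\
  forall w', langevin_solution F B L sigma w' ->
    {ae P, forall omega, w' 0 omega = w 0 omega} ->
    {ae P, forall omega, forall t : R, 0 <= t -> w' t omega = w t omega}.

End langevin.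

(* Main.v *)
Require Import Defs.
From HB Require Import structures.
From mathcomp Require Import all_boot all_order all_algebra.
From mathcomp Require Import all_classical all_reals all_analysis.
From mathcomp Require Import finmap measurable_realfun ring lra.
Import Order.TTheory GRing.Theory Num.Theory.
Import numFieldNormedType.Exports.
Set Implicit Arguments.
Unset Strict Implicit.
Unset Printing Implicit Defensive.
Local Open Scope classical_set_scope.
Local Open Scope ring_scope.

(* No stochastic integral is needed because the noise is additive: on a grid of
   mesh h the solution w is compared with the predictor
     z_{k+1} = w_k - h grad V (w_k) + sqrt (2 sigma) (B_{k+1} - B_k),
   where V = L - L_*.  Let A_k be the event that up to time k h the path stays in
   a box of size K, the predictors in the box of size K + 1, and
   V (w_{j+1}) <= V (z_{j+1}) + h delta.  These events decrease and A_k is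
   F_{k h}-measurable, hence independent of the next increment; as V >= 0, a
   nonnegative second-order Taylor upper bound of V at w_k - h grad V (w_k) and
   the Gaussian moments up to order 4 give
     E[1_{A_{k+1}} V (w_{k+1})]
       <= (1 - (l1 - sigma l2) h) E[1_{A_k} V (w_k)] + h (sigma l3 + small).
   Iterating, then letting h -> 0 and K -> oo with Fatou's lemma (almost every
   path is eventually in A_n), yields the claim; the large-time bound holds with
   C = 2. *)

(** The obstacle is that [V] has no growth bound, so its integrability along the path or at the
    predictor is not known beforehand. Cutting off large increments would spoil the Gaussian
    moments, and the indicator of [A_{k+1}] is not independent of the increment. The quartic Taylor
    bound avoids both: being nonnegative for every increment, it may be kept on all of [A_k], whose
    indicator is known at time [k h]. Expanding at [w_k - h grad V (w_k)] makes the displacement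
    exactly Gaussian: the linear and off-diagonal terms have mean zero, the diagonal ones produce
    [h sigma] times the Laplacian, and the quartic term costs only a multiple of [C h^2]. Here [C]
    depends on [K] but not on [h], which dictates the order of the limits. Passing from [w_{k+1}] to
    [z_{k+1}] is a pathwise matter: the noise cancels in the difference, and what is left is the
    error of a quadrature rule along a continuous path, [o(h)] per step. *)

(** * Moments of the centred normal law *)

Section normal_moments.
Context {R : realType}.
Notation mu := (@lebesgue_measure R).
Implicit Types (s a : R) (f F : R -> R).

(** The Radon-Nikodym derivative and [normal_pdf] have the same integral over every measurable set,
    hence agree almost everywhere. *)
Lemma ge0_integral_normal_prob m s f : s != 0 ->
  measurable_fun setT f -> (forall x, 0 <= f x) ->
  (\int[normal_prob m s]_x (f x)%:E =
   \int[mu]_x ((f x)%:E * (normal_pdf m s x)%:E))%E.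
Proof.
move=> s0 mf f0.
have mef : measurable_fun setT (fun x => (f x)%:E) by exact/measurable_EFinP.
have dom := normal_prob_dominates m s.
have iRN := Radon_Nikodym_SigmaFinite.f_integrable dom.
rewrite -(@Radon_Nikodym_SigmaFinite.change_of_variables _ _ _ _ _ dom
  (fun x => (f x)%:E) setT) => [||//|//]; last 1 first.
  by move=> x; rewrite lee_fin f0.
apply: ae_eq_integral => //.
- by apply: emeasurable_funM => //; exact: (measurable_int mu).
- apply: emeasurable_funM => //; apply/measurable_EFinP.
  exact: measurable_normal_pdf.
- apply: ae_eqe_mul2l => /=.
  apply: integral_ae_eq => //=.
  + by apply/measurable_EFinP; exact: measurable_normal_pdf.
  + move=> A _ mA.
    by rewrite -Radon_Nikodym_SigmaFinite.f_integral.
Qed.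

Lemma integral_normal_prob m s f : s != 0 ->
  (normal_prob m s).-integrable setT (EFin \o f) ->
  (\int[normal_prob m s]_x (f x)%:E =
   \int[mu]_x (f x * normal_pdf m s x)%:E)%E.
Proof.
move=> s0 /[dup] intf /integrableP[/measurable_EFinP mf foo].
rewrite integralE [RHS]integralE.
have pf x : 0 <= normal_pdf m s x by exact: normal_pdf_ge0.
congr (_ - _)%E.
- transitivity (\int[normal_prob m s]_x ((f^\+) x)%:E)%E.
    by apply: eq_integral => x _; rewrite (funerpos f).
  rewrite (ge0_integral_normal_prob m s0 (measurable_funrpos mf))//.
  apply: eq_integral => x _.
  rewrite (funerpos (fun x => f x * normal_pdf m s x)) /= -EFinM.
  by rewrite /funrpos maxr_pMl// mul0r.
- transitivity (\int[normal_prob m s]_x ((f^\-) x)%:E)%E.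
    by apply: eq_integral => x _; rewrite (funerneg f).
  rewrite (ge0_integral_normal_prob m s0 (measurable_funrneg mf))//.
  apply: eq_integral => x _.
  rewrite (funerneg (fun x => f x * normal_pdf m s x)) /= -EFinM.
  by rewrite /funrneg maxr_pMl// mul0r mulNr.
Qed.

(** Completing the square: [expR (a * x)] times the centred density is a constant times the density
    with mean [a * s ^+ 2]. *)
Lemma integral_normal_expR s a : s != 0 ->
  (\int[normal_prob 0 s]_x (expR (a * x))%:E
   = (expR (a ^+ 2 * s ^+ 2 / 2))%:E)%E.
Proof.
move=> s0; rewrite ge0_integral_normal_prob//; last first.
  by apply: measurableT_comp => //; exact: measurable_funM.
transitivity (\int[mu]_x ((expR (a ^+ 2 * s ^+ 2 / 2))%:E *
    (normal_pdf (a * s ^+ 2) s x)%:E))%E.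
  apply: eq_integral => x _; rewrite -!EFinM; congr EFin.
  rewrite !normal_pdfE//= mulrCA [RHS]mulrCA; congr (_ * _).
  rewrite /normal_fun -!expRD; congr expR.
  by field.
rewrite integralZl//.
  by rewrite integral_normal_pdf mule1.
exact: integrable_normal_pdf.
Qed.

(** Moments are computed through an antiderivative: the fundamental theorem on [[-n, n]], then
    dominated convergence. Only the difference of the two boundary values has to vanish in the
    limit. *)
Lemma integral_deriv_eq0 F f : (forall x : R, is_derive x 1 F (f x)) ->
  continuous f -> mu.-integrable setT (EFin \o f) ->
  F n%:R - F (- n%:R) @[n --> \oo] --> 0 ->
  (\int[mu]_x (f x)%:E = 0)%E.
Proof.
move=> dF cf intf F0.
pose f_ (n : nat) x := ((f \_ `[- n%:R, n%:R]) x)%:E.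
have mf : measurable_fun setT f by exact: continuous_measurable_fun.
have -> : (\int[mu]_x (f x)%:E)%E = limn (fun n => \int[mu]_x f_ n x)%E.
  apply/esym/cvg_lim => //.
  apply: (@dominated_cvg _ _ _ mu setT measurableT f_ _ (fun x => `|f x|%:E)) => //.
  - move=> n; apply/measurable_EFinP.
    apply/(measurable_restrictT f) => //; exact: measurable_funTS.
  - move=> x _; apply: cvg_near_cst.
    near=> n; rewrite /f_ patchE mem_set//=.
    rewrite in_itv/= -ler_norml.
    by near: n; exact: nbhs_infty_ger.
  - by have := integrable_norm intf.
  - move=> n x _; rewrite /f_ patchE; case: ifP => // _.
    by rewrite /= normr0 lee_fin.
apply/cvg_lim => //.
apply: (@cvg_trans _ ((F n%:R - F (- n%:R))%:E @[n --> \oo])); last first.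
  by apply: cvg_EFin => //; exact: nearW.
apply: near_eq_cvg; near=> n.
have n0 : 0 < (n%:R : R) by rewrite ltr0n; near: n; exact: nbhs_infty_gt.
transitivity (\int[mu]_(x in `[(- n%:R)%R, n%:R%R]) (f x)%:E)%E; last first.
  rewrite [LHS]integral_mkcond; apply: eq_integral => x _.
  by rewrite /f_ !patchE; case: ifP.
rewrite EFinB; apply/esym/continuous_FTC2.
- lra.
- exact: continuous_subspaceT.
- split=> [x _||].
  + by have := dF x => -[].
  + apply: cvg_at_right_filter; apply: differentiable_continuous.
    by apply/derivable1_diffP; have := dF (- n%:R) => -[].
  + apply: cvg_at_left_filter; apply: differentiable_continuous.
    by apply/derivable1_diffP; have := dF n%:R => -[].
- by move=> x _; rewrite derive1E derive_val.
Unshelve. all: by end_near. Qed.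

(** An upper bound for the true value 3: a factor 24 = 4! from the exponential series, and two
    exponentials of mean [expR 2^-1] each. *)
Definition normal_moment4_cst : R := 48 * expR 2^-1.

(** With [y = x / s], the series gives [y ^+ 4 / 4! <= expR |y|], and one of the two exponentials on
    the right equals [expR |y|]. *)
Lemma expr4_le_expR s (x : R) : 0 < s ->
  x ^+ 4 <= 24 * s ^+ 4 * (expR (s^-1 * x) + expR (- s^-1 * x)).
Proof.
move=> s0.
have H (y : R) : 0 <= y -> y ^+ 4 <= 24 * expR y.
  move=> y0; have := expR_ge1Dxn 3 y0.
  rewrite (_ : 4`!%:R = 24 :> R)//; lra.
have xE : x = s * (s^-1 * x) by rewrite mulrA divff ?mul1r// gt_eqF.
set y := s^-1 * x in xE *.
rewrite mulNr -/y xE exprMn.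
rewrite [leRHS](_ : _ = s ^+ 4 * (24 * (expR y + expR (- y)))); last by ring.
apply: ler_wpM2l; first by rewrite exprn_ge0// ltW.
have [y0|y0] := leP 0 y.
  have := H _ y0; have := expR_gt0 (- y); lra.
have : 0 <= - y by lra.
by move=> /H; have := expR_gt0 y; rewrite exprNn -signr_odd expr0 mul1r; lra.
Qed.

Lemma integral_normal_expr4 s : 0 < s ->
  (\int[normal_prob 0 s]_x (x ^+ 4)%:E <= (normal_moment4_cst * s ^+ 4)%:E)%E.
Proof.
move=> s0; have sn0 : s != 0 by rewrite gt_eqF.
have mexp (a : R) : measurable_fun setT (fun x : R => expR (a * x)).
  by apply: measurableT_comp => //; exact: measurable_funM.
apply: (@le_trans _ _ (\int[normal_prob 0 s]_x
  (24 * s ^+ 4 * (expR (s^-1 * x) + expR (- s^-1 * x)))%:E)%E).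
  apply: ge0_le_integral => //.
  - by move=> x _; rewrite lee_fin exprn_even_ge0.
  - by apply/measurable_EFinP; exact: measurable_funX.
  - apply/measurable_EFinP; apply: measurable_funM => //; apply: measurable_funD; exact: mexp.
  - by move=> x _; rewrite lee_fin expr4_le_expR.
have mE (a : R) : measurable_fun setT (fun x : R => (expR (a * x))%:E).
  exact/measurable_EFinP.
have e0 (a x : R) : (0 <= (expR (a * x))%:E)%E by rewrite lee_fin expR_ge0.
under eq_integral do rewrite EFinM EFinD.
rewrite ge0_integralZl//; last 3 first.
- by apply: emeasurable_funD; exact: mE.
- by move=> x _; exact: adde_ge0.
- by rewrite lee_fin mulr_ge0// exprn_ge0// ltW.
rewrite ge0_integralD//; [|exact: mE|exact: mE].
rewrite !integral_normal_expR// sqrrN -exprMn mulVf// expr1n mul1r.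
rewrite -EFinD -EFinM lee_fin /normal_moment4_cst le_eqVlt; apply/orP; left; apply/eqP; ring.
Qed.

Lemma integrable_normal_poly4 s f c : 0 < s -> measurable_fun setT f ->
  (forall x, `|f x| <= c * (1 + x ^+ 4)) ->
  (normal_prob 0 s).-integrable setT (EFin \o f).
Proof.
move=> s0 mf fle.
have i4 : (normal_prob 0 s).-integrable setT (EFin \o (fun x : R => x ^+ 4)).
  apply/integrableP; split.
    by apply/measurable_EFinP; exact: measurable_funX.
  under eq_integral => x _ do rewrite /= ger0_norm ?exprn_even_ge0//.
  by apply: le_lt_trans (integral_normal_expr4 s0) _; rewrite ltry.
have ig : (normal_prob 0 s).-integrable setT
    (EFin \o (fun x : R => c * (1 + x ^+ 4))).
  rewrite (_ : EFin \o _ = (fun x : R => c%:E * (1 + (x ^+ 4)%:E))%E)//.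
  apply: integrableZl => //; apply: integrableD => //.
  exact: finite_measure_integrable_cst.
apply: (le_integrable measurableT _ _ ig).
- exact/measurable_EFinP.
- move=> x _; rewrite lee_fin; apply: le_trans (fle x) _; exact: ler_norm.
Qed.

Let dpdf s (x : R) : s != 0 ->
  is_derive x 1 (normal_pdf 0 s) (- x / s ^+ 2 * normal_pdf 0 s x).
Proof.
move=> s0; rewrite normal_pdfE//.
rewrite /normal_fun.
apply: is_derive_eq.
rewrite /GRing.scale/= !subr0.
by field.
Qed.

Lemma integrable_mul_normal_pdf m s f : s != 0 ->
  (normal_prob m s).-integrable setT (EFin \o f) ->
  mu.-integrable setT (EFin \o (fun x => f x * normal_pdf m s x)).
Proof.
move=> s0 /integrableP[/measurable_EFinP mf foo].
have mp := @measurable_normal_pdf R m s.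
apply/integrableP; split; first by apply/measurable_EFinP; exact: measurable_funM.
have mnf : measurable_fun setT (fun x => `|f x|) by exact: measurableT_comp.
move: foo; rewrite /= (ge0_integral_normal_prob m s0 mnf)//.
by under eq_integral do rewrite -EFinM -(ger0_norm (normal_pdf_ge0 _ _ _)) -normrM.
Qed.

Let normr_expr2k (x : R) k : `|x| ^+ k.*2 = x ^+ k.*2.
Proof. by rewrite -normrX ger0_norm// exprn_even_ge0//= odd_double. Qed.

Lemma integrable_normal_id s : 0 < s ->
  (normal_prob 0 s).-integrable setT (EFin \o id).
Proof.
move=> s0; apply: (@integrable_normal_poly4 _ _ 1 s0) => // x; rewrite mul1r/=.
rewrite -(normr_expr2k x 2).
have := normr_ge0 x; move: `|x| => y y0.
have : 0 <= y ^+ 4 - 2 * y ^+ 2 + 1.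
  by rewrite (_ : _ + 1 = (y ^+ 2 - 1) ^+ 2) ?sqr_ge0//; ring.
have : 0 <= y ^+ 2 - 2 * y + 1.
  by rewrite (_ : _ + 1 = (y - 1) ^+ 2) ?sqr_ge0//; ring.
have : 0 <= y ^+ 4 by rewrite exprn_ge0.
lra.
Qed.

Lemma integrable_normal_sqr s : 0 < s ->
  (normal_prob 0 s).-integrable setT (EFin \o (fun x => x ^+ 2)).
Proof.
move=> s0; apply: (@integrable_normal_poly4 _ _ 1 s0) => // x.
rewrite mul1r normrX (normr_expr2k x 1).
have : 0 <= x ^+ 4 - 2 * x ^+ 2 + 1.
  by rewrite (_ : _ + 1 = (x ^+ 2 - 1) ^+ 2) ?sqr_ge0//; ring.
have := sqr_ge0 x; lra.
Qed.

Lemma integral_normal_id s : 0 < s -> (\int[normal_prob 0 s]_x x%:E = 0)%E.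
Proof.
move=> s0; have sn0 : s != 0 by rewrite gt_eqF.
have cp := @continuous_normal_pdf R 0 s sn0.
have intx := integrable_normal_id s0.
rewrite (integral_normal_prob sn0 intx).
(* [F] is an antiderivative of [f], and it is even, so its boundary values cancel exactly. *)
pose F x := - s ^+ 2 * normal_pdf 0 s x.
pose f x := x * normal_pdf 0 s x.
apply: (@integral_deriv_eq0 F f); rewrite /F /f.
- move=> x; have dp := dpdf x sn0; apply: is_derive_eq.
  rewrite /GRing.scale/=; by field.
- by move=> x; apply: cvgM => //; exact: cp.
- exact: integrable_mul_normal_pdf.
- apply: cvg_near_cst; apply: nearW => n.
  rewrite !normal_pdfE//= /normal_fun !subr0 sqrrN; ring.
Qed.

Lemma integral_normal_sqr s : 0 < s ->
  (\int[normal_prob 0 s]_x (x ^+ 2)%:E = (s ^+ 2)%:E)%E.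
Proof.
move=> s0; have sn0 : s != 0 by rewrite gt_eqF.
have cp := @continuous_normal_pdf R 0 s sn0.
have intx := integrable_normal_sqr s0.
have intc : (normal_prob 0 s).-integrable setT (EFin \o cst (s ^+ 2)).
  exact: finite_measure_integrable_cst.
have intB : (normal_prob 0 s).-integrable setT (EFin \o (fun x => x ^+ 2 - s ^+ 2)).
  by rewrite (_ : _ \o _ = ((EFin \o (fun x : R => x ^+ 2)%R) \- (EFin \o cst (s ^+ 2)%R))%E)//; exact: integrableB.
suff : (\int[normal_prob 0 s]_x (x ^+ 2 - s ^+ 2)%:E = 0)%E.
  under eq_integral do rewrite EFinB.
  rewrite integralB_EFin// integral_cst//= (@probability_setT _ _ _ (normal_prob 0 s)) mule1.
  have fx : (\int[normal_prob 0 s]_x (x ^+ 2)%:E)%E \is a fin_num.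
    exact: (integrable_fin_num _ intx).
  by move/eqP; rewrite sube_eq//= => /eqP ->; rewrite -EFinD add0r.
have := integral_normal_prob sn0 intB; rewrite /= => ->.
(* Integration by parts in disguise: differentiating [x * normal_pdf 0 s x] yields the density times
   [1 - x ^+ 2 / s ^+ 2]. *)
pose F x := - s ^+ 2 * (x * normal_pdf 0 s x).
pose f x := (x ^+ 2 - s ^+ 2) * normal_pdf 0 s x.
apply: (@integral_deriv_eq0 F f); rewrite /F /f.
- move=> x; have dp := dpdf x sn0; apply: is_derive_eq.
  rewrite /GRing.scale/=; by field.
- move=> x; apply: cvgM => //; last exact: cp.
  by apply: cvgB; [exact: exprn_continuous|exact: cvg_cst].
- exact: integrable_mul_normal_pdf.
- apply/cvgr0Pnorm_lt => e e0; near=> n.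
  have n0 : 0 < n%:R :> R by rewrite ltr0n; near: n; exact: nbhs_infty_gt.
  rewrite !normal_pdfE//= /normal_fun !subr0 sqrrN.
  set p := normal_peak s.
  have p0 : 0 <= p by exact: normal_peak_ge0.
  set y := n%:R ^+ 2 / (s ^+ 2 *+ 2).
  have y0 : 0 < y by rewrite divr_gt0// ?exprn_gt0// pmulrn_lgt0// exprn_gt0.
  (* The crude decay [expR (- y) <= y^-1] suffices: [y] is of order [n ^+ 2], while the prefactor is
     of order [n]. *)
  have ey : expR (- n%:R ^+ 2 / (s ^+ 2 *+ 2)) <= y^-1.
    rewrite mulNr -/y expRN lef_pV2 ?posrE ?expR_gt0//.
    by have := expR_ge1Dx y; lra.
  rewrite (_ : _ - _ = - (2 * s ^+ 2 * p * n%:R * expR (- n%:R ^+ 2 / (s ^+ 2 *+ 2)))); last by ring.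
  have c0 : 0 <= 2 * s ^+ 2 * p * n%:R.
    by apply: mulr_ge0 => //; apply: mulr_ge0 => //; apply: mulr_ge0 => //; exact: sqr_ge0.
  rewrite normrN ger0_norm; last by rewrite mulr_ge0// expR_ge0.
  apply: (@le_lt_trans _ _ (2 * s ^+ 2 * p * n%:R * y^-1)).
    by rewrite ler_wpM2l.
  rewrite (_ : _ * _ = (4 * s ^+ 4 * p) / n%:R); last first.
    by rewrite /y; field; rewrite sn0 gt_eqF.
  rewrite ltr_pdivrMr// -ltr_pdivrMl// mulrC.
  by near: n; exact: nbhs_infty_gtr.
Unshelve. all: by end_near. Qed.

End normal_moments.

(** * Directional derivatives of C1 functions *)

Section calculus_rV.
Context {R : realType} {d : nat}.
Implicit Types (f g V : 'rV[R]_d -> R) (x y v D : 'rV[R]_d).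

Lemma rV_norm_le v (c : R) : 0 <= c -> (forall i, `|v ord0 i| <= c) -> `|v| <= c.
Proof.
move=> c0 H; rewrite -[ `|v| ]/(mx_norm v) mx_normrE; apply: bigmax_le => // -[i j] _ /=.
by rewrite ord1.
Qed.

Lemma rV_coord_le v i : `|v ord0 i| <= `|v|.
Proof.
rewrite -[ `|v| ]/(mx_norm v) mx_normrE.
by apply: (le_bigmax _ (fun ij : 'I_1 * 'I_d => `|v ij.1 ij.2|) (ord0, i)).
Qed.

Lemma is_derive_line f x v (a : R) : derivable f (x + a *: v) v ->
  is_derive a 1 (fun t : R => f (x + t *: v)) ('D_v f (x + a *: v)).
Proof.
have E : (fun h : R => h^-1 *:
    (((fun t : R => f (x + t *: v)) \o shift a) (h *: (1 : R)) - f (x + a *: v)))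
  = (fun h : R => h^-1 *: ((f \o shift (x + a *: v)) (h *: v) - f (x + a *: v))).
  apply/funext => h /=; congr (_ *: (f _ - _)).
  by rewrite [h *: (1 : R)]mulr1 scalerDl addrCA.
by move=> df; split; rewrite /derivable /derive E.
Qed.

(** Writing the intermediate point as [theta * a] makes one statement serve for both signs of [a]
    and for [a = 0]. *)
Lemma MVT_theta (f df : R -> R) (a : R) :
  (forall x : R, is_derive x 1 f (df x)) ->
  exists theta : R, 0 <= theta <= 1 /\ f a - f 0 = df (theta * a) * a.
Proof.
move=> fd.
have cf (A : set R) : {within A, continuous f}.
  apply: continuous_subspaceT => x; apply: differentiable_continuous.
  by apply/derivable1_diffP; have := fd x => -[].
have [a0|a0|->] := ltgtP a 0; last first.
- by exists 0; rewrite subrr mulr0 lexx ler01.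
- have [c + fE] := MVT a0 (fun (x : R) _ => fd x) (cf _).
  rewrite in_itv/= => /andP[c0 ca]; exists (c / a).
  rewrite divfK ?gt_eqF// fE subr0; split=> //; apply/andP; split.
    by rewrite divr_ge0// ltW.
  by rewrite ler_pdivrMr// mul1r ltW.
- have [c + fE] := MVT a0 (fun (x : R) _ => fd x) (cf _).
  rewrite in_itv/= => /andP[ca c0]; exists (c / a).
  rewrite divfK ?lt_eqF//; split; last by rewrite -opprB fE sub0r mulrN opprK.
  apply/andP; split; first by rewrite ler_ndivlMr// mul0r ltW.
  by rewrite ler_ndivrMr// mul1r ltW.
Qed.

Section C1.
Variable f : 'rV[R]_d -> R.
Hypothesis f1 : C1 f.

Lemma C1_partial_MVT i x (a : R) : exists theta : R, 0 <= theta <= 1 /\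
  f (x + a *: delta_mx ord0 i) - f x
    = partial f i (x + (theta * a) *: delta_mx ord0 i) * a.
Proof.
have [_ df _] := f1.
have [|theta [t01]] := @MVT_theta (fun t => f (x + t *: delta_mx ord0 i))
   (fun t => partial f i (x + t *: delta_mx ord0 i)) a.
  by move=> t; exact: is_derive_line.
by rewrite scale0r addr0 => E; exists theta.
Qed.

(** The points [x + h *: trunc v k] form a staircase from [x] to [x + h *: v] that moves along one
    axis at a time. *)
Let trunc v (k : nat) : 'rV[R]_d := \row_i (if (i < k)%N then v ord0 i else 0).

Let truncS v (i : 'I_d) : trunc v i.+1 = trunc v i + v ord0 i *: delta_mx ord0 i.
Proof.
apply/rowP => j; rewrite !mxE eqxx/= ltnS leq_eqVlt.
have [->|ji] := eqVneq j i; first by rewrite eqxx ltnn add0r mulr1.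
by rewrite (negbTE (ji : (j : nat) != i)) /= mulr0 addr0.
Qed.

(** The increment telescopes along the staircase. On each step the one-variable mean value theorem
    gives a partial derivative at a point tending to [x] with [h], and the partial derivatives are
    continuous. *)
Lemma C1_derivable_dir x v :
  h^-1 *: (f (x + h *: v) - f x) @[h --> 0^'] -->
    \sum_i v ord0 i * partial f i x.
Proof.
have [_ _ cf] := f1.
have E h : f (x + h *: v) - f x =
    \sum_(i < d) (f (x + h *: trunc v i.+1) - f (x + h *: trunc v i)).
  rewrite -(big_mkord xpredT (fun i =>
    f (x + h *: trunc v i.+1) - f (x + h *: trunc v i))) telescope_sumr//.
  congr (f (_ + _ *: _) - f _).
    by apply/rowP => j; rewrite !mxE ltn_ord.
  by rewrite (_ : trunc v 0 = 0) ?scaler0 ?addr0//; apply/rowP => j; rewrite !mxE.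
under eq_fun do rewrite E scaler_sumr.
apply: cvg_big => //; first exact: add_continuous.
move=> i _; rewrite truncS.
apply/cvgrPdist_le => e e0.
have : \forall y \near x, `|partial f i x - partial f i y| * `|v ord0 i| <= e.
  have e1 : 0 < e / (`|v ord0 i| + 1) by rewrite divr_gt0// ltr_wpDl.
  have /cvgrPdist_le/(_ _ e1) := cf i x; apply: filterS => y.
  rewrite ler_pdivlMr ?ltr_wpDl//; apply: le_trans.
  by rewrite ler_wpM2l// lerDl.
move=> /nbhs_ballP[r /= r0 rP].
have r1 : 0 < r / (`|v| + 1) by rewrite divr_gt0// ltr_wpDl.
near=> h.
have h0 : h != 0 by near: h; exact: nbhs_dnbhs_neq.
rewrite [X in f (_ + X)]scalerDr addrA scalerA.
have [theta [/andP[t0 t1] ->]] := C1_partial_MVT i (x + h *: trunc v i) (h * v ord0 i).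
set y := (X in _ *: (partial f i X * _)).
rewrite [_ *: _](_ : _ = partial f i y * v ord0 i); last first.
  by rewrite /GRing.scale/=; field.
rewrite [v ord0 i * _]mulrC -mulrBl normrM; apply: rP.
rewrite -ball_normE /= distrC (_ : y - x = h *: trunc v i + (theta * (h * v ord0 i)) *: delta_mx ord0 i); last first.
  by rewrite /y -[x + _ + _]addrA [x + (_ + _)]addrC addrK.
(* [trunc v i] vanishes at coordinate [i], so the two summands have disjoint supports and their sup
   norms do not add up. *)
apply: (@le_lt_trans _ _ (`|h| * `|v|)).
  apply: rV_norm_le; first by rewrite mulr_ge0.
  move=> j; rewrite !mxE eqxx/=.
  have [->|ji] := eqVneq j i.
    rewrite ltnn mulr0 add0r mulr1 !normrM (ger0_norm t0).
    rewrite mulrCA ler_wpM2l//; apply: le_trans (rV_coord_le v i).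
    by rewrite ler_piMl.
  rewrite mulr0 addr0 normrM ler_wpM2l//.
  by case: ifP => _; [exact: rV_coord_le|rewrite normr0].
have hr : `|h| < r / (`|v| + 1) by near: h; exact: dnbhs0_lt.
rewrite (@le_lt_trans _ _ (`|h| * (`|v| + 1)))//.
  by rewrite ler_wpM2l// lerDl.
by rewrite -ltr_pdivlMr// ltr_wpDl.
Unshelve. all: by end_near. Qed.

Lemma C1_is_derive_line x v (a : R) :
  is_derive a 1 (fun t : R => f (x + t *: v))
    (\sum_i v ord0 i * partial f i (x + a *: v)).
Proof.
have H := @C1_derivable_dir (x + a *: v) v.
have E : (fun h : R => h^-1 *: (f (x + a *: v + h *: v) - f (x + a *: v)))
  = (fun h : R => h^-1 *: ((f \o shift (x + a *: v)) (h *: v) - f (x + a *: v))).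
  by apply/funext => h /=; rewrite [h *: v + _]addrC.
rewrite E in H.
have dv : derivable f (x + a *: v) v by apply/cvg_ex; eexists; exact: H.
have dE : 'D_v f (x + a *: v) = \sum_i v ord0 i * partial f i (x + a *: v).
  exact: cvg_lim H.
by rewrite -dE; exact: is_derive_line.
Qed.

End C1.
End calculus_rV.

(** * Uniform bounds and moduli of continuity on compact sets *)

Section compact_family.
Context {R : realType}.

Lemma compact_bounded_family (U : normedModType R) (I : finType)
    (g : I -> U -> R) (A : set U) : compact A -> (forall i, continuous (g i)) ->
  exists2 M, 0 <= M & forall i x, A x -> `|g i x| <= M.
Proof.
move=> cA cg.
have : \forall M \near +oo, forall i x, A x -> `|g i x| <= M.
  apply: filter_forall => i.
  have /compact_bounded[M0 [M0r M0P]] : compact (g i @` A).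
    by apply: continuous_compact => //; exact: continuous_subspaceT.
  near=> M => x Ax; apply: (M0P M); last by exists x.
  by near: M; exact: nbhs_pinfty_gt.
move=> /filterI/(_ (nbhs_pinfty_ge (num_real 0)))/filter_ex[M [MP M0]].
by exists M.
Unshelve. all: by end_near. Qed.

(** Only [x] is confined to [A]: the segments and gradient steps considered later may leave the box.
    The near-covering form of compactness turns local radii into a common one. *)
Lemma compact_unif_continuous_family (U : normedModType R) (I : finType)
    (g : I -> U -> R) (A : set U) (e : R) :
  compact A -> (forall i, continuous (g i)) -> 0 < e ->
  exists2 r, 0 < r & forall i x y, A x -> `|x - y| <= r ->
    `|g i x - g i y| <= e.
Proof.
move=> cA cg e0.
have : \forall r \near (0 : R)^'+, forall i x y, A x -> `|x - y| <= r ->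
    `|g i x - g i y| <= e.
  apply: filter_forall => i.
  have /compact_near_coveringP := cA.
  move=> /(_ _ (0 : R)^'+ (fun r x => forall y, `|x - y| <= r -> `|g i x - g i y| <= e)) cov.
  suff /cov : forall x, A x -> \forall x' \near x & r \near (0 : R)^'+,
      forall y, `|x' - y| <= r -> `|g i x' - g i y| <= e.
    by apply: filterS => r H x y Ax; exact: H.
  move=> x _.
  have e2 : 0 < e / 2 by rewrite divr_gt0.
  have /cvgrPdist_lt/(_ _ e2)/nbhs_ballP[r /= r0 rP] := cg i x.
  have r2 : 0 < r / 2 by rewrite divr_gt0.
  exists (ball x (r / 2), [set s | s < r / 2]) => /=.
    by split; [exact: nbhsx_ballx|exact: nbhs_right_lt].
  move=> [x' s]/= [xx' sr] y x'y.
  rewrite -ball_normE/= in xx'.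
  have h1 : `|g i x - g i x'| < e / 2.
    by apply: rP; rewrite -ball_normE/= (lt_le_trans xx')// ler_pdivrMr// ler_peMr ?ler1n// ltW.
  have h2 : `|g i x - g i y| < e / 2.
    apply: rP; rewrite -ball_normE/=.
    rewrite -(subrKA x') (le_lt_trans (ler_normD _ _))//.
    by rewrite [ltRHS]splitr ltrD// (le_lt_trans x'y).
  rewrite -(subrKA (g i x)) (le_trans (ler_normD _ _))// distrC.
  by rewrite [leRHS]splitr lerD// ltW.
move=> /filterI/(_ (nbhs_right_gt 0))/filter_ex[r [rP r0]].
by exists r => // i x y Ax; exact: rP.
Qed.

End compact_family.

Section box.
Context {R : realType} {d : nat}.
Implicit Types (f g V : 'rV[R]_d -> R) (x y v D : 'rV[R]_d) (K : R).

Lemma compact_box K : compact [set x : 'rV[R]_d | `|x| <= K].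
Proof.
apply: bounded_closed_compact.
  exists K; split; first exact: num_real.
  by move=> M KM x /= xK; rewrite (le_trans xK)// ltW.
rewrite (_ : [set _ | _] = [eta Num.norm] @^-1` [set r : R | r <= K])//.
apply: preimage_closed; first by move=> x _; exact: norm_continuous.
exact: closed_le.
Qed.

Lemma box_bounded (I : finType) (g : I -> 'rV[R]_d -> R) K :
  (forall i, continuous (g i)) ->
  exists2 M, 0 <= M & forall i x, `|x| <= K -> `|g i x| <= M.
Proof.
move=> cg; have [M M0 MP] := compact_bounded_family (@compact_box K) cg.
by exists M.
Qed.

Lemma box_unif_continuous (I : finType) (g : I -> 'rV[R]_d -> R) K (e : R) :
  (forall i, continuous (g i)) -> 0 < e ->
  exists2 r, 0 < r & forall i x y, `|x| <= K -> `|x - y| <= r ->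
    `|g i x - g i y| <= e.
Proof.
move=> cg e0.
have [r r0 rP] := compact_unif_continuous_family (@compact_box K) cg e0.
by exists r.
Qed.

End box.

(** * Second-order Taylor bounds *)

Section taylor.
Context {R : realType} {d : nat}.
Implicit Types (f g V : 'rV[R]_d -> R) (x y v D : 'rV[R]_d) (K : R).

(** Subtracting the quadratic with second derivative [M] leaves a function [g] whose derivative is
    nonpositive on the unit interval, by a second use of the mean value theorem. *)
Lemma taylor2_le (f f1 f2 : R -> R) (M : R) :
  (forall t : R, is_derive t 1 f (f1 t)) ->
  (forall t : R, is_derive t 1 f1 (f2 t)) ->
  (forall t, 0 <= t <= 1 -> f2 t <= M) ->
  f 1 <= f 0 + f1 0 + M / 2.
Proof.
move=> df df1 f2M.
pose g t := f t - (f1 0 * t + M / 2 * t ^+ 2).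
pose g1 t := f1 t - (f1 0 + M * t).
have dg (t : R) : is_derive t 1 g (g1 t).
  have := df t => ?; apply: is_derive_eq.
  by rewrite /GRing.scale/= /g1; field.
have [theta [/andP[t0 t1]]] := MVT_theta 1 dg.
have [eta [/andP[e0 e1]]] := MVT_theta (theta * 1) df1.
rewrite /g /g1 !mulr1 expr1n expr0n/= !mulr0 addr0 subr0 => E1 E2.
have /f2M f2le : 0 <= eta * theta <= 1.
  by rewrite mulr_ge0//= mulr_ile1.
have : f2 (eta * theta) * theta <= M * theta by rewrite ler_wpM2r.
lra.
Qed.

Definition hess V (i j : 'I_d) : 'rV[R]_d -> R := partial (partial V i) j.

Definition sqsum D : R := \sum_i D ord0 i ^+ 2.

Lemma sqsum_ge0 D : 0 <= sqsum D.
Proof. by apply: sumr_ge0 => i _; exact: sqr_ge0. Qed.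

Lemma C2_taylor_le V x D (M : R) : C2 V ->
  (forall s, 0 <= s <= 1 ->
    \sum_i \sum_j D ord0 i * D ord0 j * hess V i j (x + s *: D) <= M) ->
  V (x + D) <= V x + \sum_i D ord0 i * partial V i x + M / 2.
Proof.
move=> [V1 pV1] HM.
have := @taylor2_le (fun t => V (x + t *: D))
  (fun t => \sum_i D ord0 i * partial V i (x + t *: D))
  (fun t => \sum_i \sum_j D ord0 i * D ord0 j * hess V i j (x + t *: D)) M.
rewrite scale1r scale0r addr0; apply => // t; first exact: C1_is_derive_line.
have dp (i : 'I_d) := C1_is_derive_line (pV1 i) x D t.
rewrite (_ : (fun _ => _) =
  \sum_i (fun t => D ord0 i * partial V i (x + t *: D))); last first.
  by apply/funext => s; rewrite fct_sumE.
apply: is_derive_eq.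
apply: eq_bigr => i _; rewrite /GRing.scale/= mulr_sumr.
by apply: eq_bigr => j _; rewrite mulrA.
Qed.

(** Each product is at most half the sum of the two squares, and every square occurs [d] times on
    either side. *)
Lemma sum_cross_le (e : R) (a : 'I_d -> 'I_d -> R) D :
  0 <= e -> (forall i j, `|a i j| <= e) ->
  \sum_i \sum_j D ord0 i * D ord0 j * a i j <= e * d%:R * sqsum D.
Proof.
move=> e0 ae.
apply: (@le_trans _ _
    (\sum_i \sum_j (e / 2 * D ord0 i ^+ 2 + e / 2 * D ord0 j ^+ 2))).
  apply: ler_sum => i _; apply: ler_sum => j _.
  apply: le_trans (ler_norm _) _; rewrite normrM.
  apply: (@le_trans _ _ (`|D ord0 i * D ord0 j| * e)); first by rewrite ler_wpM2l.
  rewrite normrM -!(real_normK (num_real (D ord0 _))).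
  move: `|D ord0 i| `|D ord0 j| => p q.
  rewrite -subr_ge0 (_ : _ - _ = e / 2 * (p - q) ^+ 2); last by field.
  by rewrite mulr_ge0 ?sqr_ge0 ?divr_ge0.
under eq_bigr do rewrite big_split/= sumr_const card_ord -mulr_sumr.
rewrite big_split/= sumr_const card_ord sumrMnl -mulr_sumr -/(sqsum D).
rewrite -mulrnDl -[leLHS]mulr_natr le_eqVlt; apply/orP; left; apply/eqP.
by field.
Qed.

Lemma norm_expr4_le D : `|D| ^+ 4 <= \sum_i D ord0 i ^+ 4.
Proof.
have p4 (a : R) : 0 <= a ^+ 4 by rewrite exprn_even_ge0.
have [->|D0] := eqVneq D 0.
  by rewrite normr0 expr0n/= sumr_ge0.
have /mx_norm_neq0[[i j] /= Dij] : mx_norm D != 0.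
  by apply: contra_neq D0 => /mx_norm_eq0.
rewrite -[ `|D| ]/(mx_norm D) Dij ord1 -normrX ger0_norm//.
by rewrite (bigD1 j)//= lerDl sumr_ge0.
Qed.

Definition taylor_bound V (e C : R) x D : R :=
  V x + \sum_i D ord0 i * partial V i x
    + 2^-1 * \sum_i \sum_j D ord0 i * D ord0 j * hess V i j x
    + e * sqsum D + C * \sum_i D ord0 i ^+ 4.

(* The quartic term dominates the quadratic Taylor polynomial for large [D],
   so that the bound is nonnegative on all increments and needs no cutoff. *)
Lemma taylor_bound_box V K (e : R) : C2 V -> (forall x, 0 <= V x) -> 0 < e ->
  exists2 C, 0 <= C & forall x D, `|x| <= K ->
    0 <= taylor_bound V e C x D /\
    (`|x + D| <= K -> V (x + D) <= taylor_bound V e C x D).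
Proof.
move=> V2 V0 e0; have [[cV _ cdV] /(_ _)V1] := V2.
have ch (ij : 'I_d * 'I_d) : continuous (hess V ij.1 ij.2).
  by have [_ _] := V1 ij.1; apply.
pose e1 := e / (d%:R + 1).
have d0 : 0 < d%:R + 1 :> R by rewrite ltr_wpDl.
have e10 : 0 < e1 by rewrite divr_gt0.
have [r r0 rP] := box_unif_continuous K ch e10.
have [M1 M10 M1P] := @box_bounded R d unit (fun _ => V) K (fun _ => cV).
have [M2 M20 M2P] := box_bounded K cdV.
have [M3 M30 M3P] := box_bounded K ch.
(* For [|D| > r], [|D| ^+ k] is at most the quartic sum over [r ^+ (4 - k)]; the three terms pay for
   the constant, linear and quadratic parts. One [M1] covers a lower bound of [V x], the other
   remains as the final lower bound. *)
pose A := (M1 *+ 2) / r ^+ 4 + d%:R * M2 / r ^+ 3 + 2^-1 * (d%:R * d%:R * M3) / r ^+ 2.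
have A0 : 0 <= A.
  have rn k : 0 <= r ^+ k by rewrite exprn_ge0// ltW.
  apply: addr_ge0; first (apply: addr_ge0); apply: divr_ge0 => //.
  - by rewrite mulrn_wge0.
  - by rewrite mulr_ge0.
  - by rewrite !mulr_ge0.
exists A => // x D xK.
have S4 : 0 <= \sum_i D ord0 i ^+ 4.
  by apply: sumr_ge0 => i _; rewrite exprn_even_ge0.
have S2 := sqsum_ge0 D.
(* For small [D] this is the true Taylor estimate, with the modulus of continuity of the Hessian;
   nonnegativity then follows from that of [V]. *)
have [Dr|rD] := leP `|D| r.
  suff H : V (x + D) <= taylor_bound V e A x D.
    by split => //; apply: le_trans H.
  have := @C2_taylor_le V x D
    (\sum_i \sum_j D ord0 i * D ord0 j * hess V i j x + e1 * d%:R * sqsum D) V2.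
  move=> /(_ _)/le_trans -> //; last first.
    rewrite /taylor_bound -!addrA !lerD2l mulrDl mulrC lerD2l.
    apply: (@le_trans _ _ (e * sqsum D)); last by rewrite lerDl mulr_ge0.
    rewrite mulrAC ler_wpM2r//.
    have e1d : e1 * d%:R <= e.
      by rewrite /e1 mulrAC ler_pdivrMr// ler_wpM2l ?ltW// ltrDl.
    have : 0 <= e1 * d%:R by rewrite mulr_ge0// ltW.
    lra.
  move=> s /andP[s0 s1]; rewrite -lerBlDl -sumrB.
  under eq_bigr do rewrite -sumrB.
  under eq_bigr do under eq_bigr do rewrite -mulrBr.
  apply: sum_cross_le; first exact: ltW.
  move=> i j; rewrite distrC; apply: (rP (i, j)) => //.
  by rewrite opprD addNKr normrN normrZ ger0_norm// (le_trans _ Dr)// ler_piMl.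
have D0 : 0 < `|D| by rewrite (lt_trans r0).
have rk k : (k <= 4)%N -> `|D| ^+ k <= \sum_i D ord0 i ^+ 4 / r ^+ (4 - k).
  move=> k4; apply: (@le_trans _ _ (`|D| ^+ 4 / r ^+ (4 - k))); last first.
    by rewrite -mulr_suml ler_wpM2r ?norm_expr4_le// invr_ge0 exprn_ge0// ltW.
  rewrite ler_pdivlMr ?exprn_gt0// -{2}(subnKC k4) exprD ler_wpM2l ?exprn_ge0//.
  by rewrite lerXn2r// ?nnegrE ltW.
have cD i : `|D ord0 i| <= `|D| by exact: rV_coord_le.
have T1 : - (d%:R * M2 * `|D|) <= \sum_i D ord0 i * partial V i x.
  rewrite lerNl -sumrN (le_trans (y := \sum_(i < d) (M2 * `|D|)))//; last first.
    by rewrite sumr_const card_ord -[leLHS]mulr_natl mulrA.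
  apply: ler_sum => i _; apply: le_trans (ler_norm _) _.
  by rewrite normrN normrM mulrC ler_pM// M2P.
have T2 : - (d%:R * d%:R * M3 * `|D| ^+ 2) <=
    \sum_i \sum_j D ord0 i * D ord0 j * hess V i j x.
  rewrite lerNl -sumrN (le_trans (y := \sum_(i < d) \sum_(j < d) (M3 * `|D| ^+ 2)))//.
    apply: ler_sum => i _; rewrite -sumrN; apply: ler_sum => j _.
    apply: le_trans (ler_norm _) _.
    rewrite normrN !normrM mulrC ler_pM// ?mulr_ge0//.
      exact: (M3P (i, j)).
    by rewrite expr2 ler_pM.
  by rewrite !sumr_const !card_ord -[leLHS]mulr_natl -[X in _ * X]mulr_natl !mulrA.
have R0 := rk 0%N isT; have R1 := rk 1%N isT; have R2 := rk 2%N isT.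
rewrite expr0 -mulr_suml in R0.
rewrite expr1 -mulr_suml in R1.
rewrite -mulr_suml in R2.
(* For large [D] one lower bound settles both claims: [M1] is nonnegative, and it bounds [V] on the
   box. *)
have bound : M1 <= V x + taylor_bound V e A x D - V x.
  have Vx : - M1 <= V x by have := M1P tt x xK; rewrite ler_norml => /andP[].
  rewrite /taylor_bound /A.
  set S := \sum_i D ord0 i ^+ 4 in S4 R0 R1 R2 *.
  have E0 : M1 *+ 2 <= M1 *+ 2 * (S / r ^+ 4).
    by rewrite -[leLHS]mulr1 ler_wpM2l// mulrn_wge0.
  have E1 : d%:R * M2 * `|D| <= d%:R * M2 * (S / r ^+ 3).
    by rewrite ler_wpM2l// mulr_ge0.
  have E2 : d%:R * d%:R * M3 * `|D| ^+ 2 <= d%:R * d%:R * M3 * (S / r ^+ 2).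
    by rewrite ler_wpM2l// !mulr_ge0.
  have eS : 0 <= e * sqsum D by rewrite mulr_ge0// ltW.
  rewrite [(_ + _ + _) * S](_ : _ = M1 *+ 2 * (S / r ^+ 4) +
     d%:R * M2 * (S / r ^+ 3) + 2^-1 * (d%:R * d%:R * M3 * (S / r ^+ 2))); last first.
    by field; rewrite gt_eqF.
  move: E0; rewrite mulr2n; lra.
rewrite addrAC subrr add0r in bound.
split; first exact: le_trans bound.
move=> xDK; apply: le_trans bound.
by apply: le_trans (ler_norm _) _; exact: (M1P tt).
Qed.

End taylor.

(** * The gradient step *)

Section drift.
Context {R : realType} {d : nat}.
Implicit Types (f g V : 'rV[R]_d -> R) (x y v D : 'rV[R]_d) (K : R).

Lemma enorm_sqr v : enorm v ^+ 2 = sqsum v.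
Proof. by rewrite sqr_sqrtr// sqsum_ge0. Qed.

Lemma laplacianE V x : laplacian V x = \sum_i hess V i i x.
Proof. by []. Qed.

Lemma C1_box_lipschitz V K : C1 V ->
  exists2 c, 0 <= c & forall x y, `|x| <= K -> `|y| <= K ->
    `|V x - V y| <= c * `|x - y|.
Proof.
move=> V1; have [_ _ cdV] := V1.
have [M M0 MP] := box_bounded K cdV.
exists (d%:R * M) => [|x y xK yK]; first by rewrite mulr_ge0.
have [theta [/andP[t0 t1]]] := MVT_theta 1 (C1_is_derive_line V1 y (x - y)).
rewrite scale1r scale0r addr0 subrKC !mulr1 => ->.
apply: le_trans (ler_norm_sum _ _ _) _.
apply: (@le_trans _ _ (\sum_(i < d) (M * `|x - y|))); last first.
  by rewrite sumr_const card_ord -[leLHS]mulr_natl mulrA.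
apply: ler_sum => i _; rewrite normrM mulrC ler_pM// ?rV_coord_le// MP//.
rewrite (_ : y + _ = (1 - theta) *: y + theta *: x); last first.
  by rewrite scalerBr scalerBl scale1r addrAC addrA.
apply: le_trans (ler_normD _ _) _; rewrite !normrZ !ger0_norm ?subr_ge0//.
rewrite (_ : K = (1 - theta) * K + theta * K); last by ring.
by rewrite lerD// ler_wpM2l ?subr_ge0.
Qed.

(** The Gaussian second moments produce the Laplacian at the moved point, whereas the assumptions
    are to be applied at [x]; both terms are brought back to [x] with an error [h * e], uniformly on
    the box. *)
Lemma euler_drift_le V (s K e : R) : C2 V -> 0 <= s -> 0 < e ->
  \forall h \near (0 : R)^'+, forall x, `|x| <= K ->
    `|x - h *: grad V x| <= K + 1 /\
    V (x - h *: grad V x) + h * s * laplacian V (x - h *: grad V x)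
      <= V x - h * enorm (grad V x) ^+ 2 + h * s * laplacian V x + h * e.
Proof.
move=> V2 s0 e0; have [V1 pV1] := V2; have [_ _ cdV] := V1.
have ch (i : 'I_d) : continuous (hess V i i) by have [_ _] := pV1 i; apply.
have [M M0 MP] := box_bounded K cdV.
(* The gradient contributes an error [h * d * M * e1], the Laplacian [h * s * d * e1]. *)
pose e1 := e / (d%:R * M + s * d%:R + 1).
have c0 : 0 <= d%:R * M + s * d%:R by rewrite addr_ge0 ?mulr_ge0.
have e10 : 0 < e1 by rewrite divr_gt0// ltr_wpDl.
have [r1 r10 r1P] := box_unif_continuous K cdV e10.
have [r2 r20 r2P] := box_unif_continuous K ch e10.
have M1 : 0 < M + 1 by rewrite ltr_wpDl.
near=> h => x xK.
have h0 : 0 < h by near: h; exact: nbhs_right_gt.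
have gM : `|grad V x| <= M by apply: rV_norm_le => // i; rewrite mxE MP.
have hgM (c : R) : h < c / (M + 1) -> h * `|grad V x| <= c.
  rewrite ltr_pdivlMr// => /ltW; apply: le_trans.
  by apply: ler_wpM2l; [exact: ltW|apply: le_trans gM _; rewrite lerDl].
split.
  apply: le_trans (ler_normB _ _) _; rewrite lerD// normrZ gtr0_norm//.
  by apply: hgM; near: h; apply: nbhs_right_lt; rewrite divr_gt0.
have hr1 : h * `|grad V x| <= r1.
  by apply: hgM; near: h; apply: nbhs_right_lt; rewrite divr_gt0.
have hr2 : h * `|grad V x| <= r2.
  by apply: hgM; near: h; apply: nbhs_right_lt; rewrite divr_gt0.
have lapE : laplacian V (x - h *: grad V x) <= laplacian V x + d%:R * e1.
  rewrite !laplacianE -lerBlDl -sumrB.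
  apply: (@le_trans _ _ (\sum_(i < d) e1)); last by rewrite sumr_const card_ord mulr_natl.
  apply: ler_sum => i _; apply: le_trans (ler_norm _) _.
  by rewrite distrC; apply: r2P => //; rewrite opprB addrC subrK normrZ gtr0_norm.
have [theta [/andP[t0 t1]]] := MVT_theta h (C1_is_derive_line V1 x (- grad V x)).
rewrite scale0r addr0 scalerN => E.
have VE : V (x - h *: grad V x) <= V x + h * (- sqsum (grad V x) + d%:R * (M * e1)).
  rewrite -lerBlDl E mulrC ler_wpM2l ?(ltW h0)//.
  rewrite /sqsum -sumrN (_ : _ * (M * e1) = \sum_(i < d) (M * e1)); last first.
    by rewrite sumr_const card_ord mulr_natl.
  rewrite -big_split/=; apply: ler_sum => i _; rewrite !mxE.
  set p := partial V i x; set q := partial V i _.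
  have pq : `|p - q| <= e1.
    apply: r1P => //; rewrite scalerN opprB addrC subrK normrZ.
    rewrite ger0_norm ?mulr_ge0 ?(ltW h0)//; apply: le_trans hr1.
    by rewrite ler_wpM2r// ler_piMl// ltW.
  rewrite -lerBlDl (_ : _ - _ = p * (p - q)); last by ring.
  apply: le_trans (ler_norm _) _; rewrite normrM ler_pM//.
  exact: MP.
have ee : (d%:R * M + s * d%:R) * e1 <= e.
  by rewrite /e1 mulrCA ler_piMr ?(ltW e0)// ler_pdivrMr ?mul1r ?lerDl// ltr_wpDl.
rewrite enorm_sqr.
have hs0 : 0 <= h * s by rewrite mulr_ge0// ltW.
apply: le_trans (lerD VE (ler_wpM2l hs0 lapE)) _.
rewrite -subr_ge0 (_ : _ - _ = h * e - h * ((d%:R * M + s * d%:R) * e1)).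
  by rewrite subr_ge0 ler_wpM2l// ltW.
move: (V x) (laplacian V x) (sqsum _) => a b c; ring.
Unshelve. all: by end_near. Qed.

End drift.

(** * Vanishing conditional means *)

Section uncorrelated.
Context {R : realType} {disp : measure_display} {T : measurableType disp}.
Variable P : {finite_measure set T -> \bar R}.
Implicit Types (g psi : T -> R).
Import HBNNSimple.

Let integral_simple_comp_eq0 (phi : {nnsfun R >-> R}) g psi :
  measurable_fun setT g -> P.-integrable setT (EFin \o psi) ->
  (forall U, measurable U -> \int[P]_(x in g @^-1` U) (psi x)%:E = 0)%E ->
  (\int[P]_x (phi (g x) * psi x)%:E = 0)%E.
Proof.
move=> mg ipsi H0.
pose s : seq R := fset_set (phi @` setT).
pose A (y : R) := phi @^-1` [set y].
have mA i : measurable (g @^-1` A i).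
  by rewrite -[_ @^-1` _]setTI; apply: mg => //; exact: measurable_funPTI.
pose F (i : R) x : \bar R := (i%:E * ((psi \_ (g @^-1` A i)) x)%:E)%E.
have iF i : P.-integrable setT (F i).
  apply: integrableZl => //.
  have /(integrable_mkcond (EFin \o psi) (mA i)) := integrableS measurableT (mA i) (@subsetT _ _) ipsi.
  by apply: eq_integrable => // x _; rewrite /= !patchE; case: ifP.
transitivity (\int[P]_x (\sum_(i <- s) F i x))%E.
  apply: eq_integral => x _; rewrite fimfunE fsbig_finite//= mulr_suml -sumEFin.
  apply: eq_bigr => i _; rewrite /F -EFinM -mulrA; congr ((_ * _)%:E).
  rewrite patchE indicE /A /= (_ : (x \in _) = (g x \in phi @^-1` [set i])).
    by case: ifP; rewrite ?mul1r ?mul0r.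
  by apply/idP/idP => /set_mem H; apply/mem_set.
rewrite integral_sum// big1// => i _.
rewrite /F integralZl//; last first.
  have /(integrable_mkcond (EFin \o psi) (mA i)) := integrableS measurableT (mA i) (@subsetT _ _) ipsi.
  by apply: eq_integrable => // x _; rewrite /= !patchE; case: ifP.
rewrite (_ : (\int[P]_x _)%E = (\int[P]_(x in g @^-1` A i) (psi x)%:E)%E); last first.
  by rewrite [RHS]integral_mkcond; apply: eq_integral => x _; rewrite /= !patchE; case: ifP.
by rewrite H0 ?mule0//; rewrite /A; exact: measurable_funPTI.
Qed.

Let integral_ge0_comp_eq0 (k : R -> R) g psi : (forall x, 0 <= k x) ->
  measurable_fun setT k ->
  measurable_fun setT g -> P.-integrable setT (EFin \o psi) ->
  P.-integrable setT (fun x => (k (g x) * psi x)%:E) ->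
  (forall U, measurable U -> \int[P]_(x in g @^-1` U) (psi x)%:E = 0)%E ->
  (\int[P]_x (k (g x) * psi x)%:E = 0)%E.
Proof.
move=> k0 mk mg ipsi ikpsi H0.
have mek : measurable_fun setT (fun x => (k x)%:E) by exact/measurable_EFinP.
pose phi := nnsfun_approx measurableT mek.
have phile n x : phi n x <= k x.
  have := @le_approx _ _ _ setT (fun x => (k x)%:E) n x.
  by rewrite /phi nnsfun_approxE lee_fin; apply => // y _; rewrite lee_fin.
have mpsi : measurable_fun setT psi.
  by apply/measurable_EFinP; exact: (measurable_int P).
suff cv : (\int[P]_x (phi n (g x) * psi x)%:E)%E @[n --> \oo] -->
    (\int[P]_x (k (g x) * psi x)%:E)%E.
  have E0 : (fun n => \int[P]_x (phi n (g x) * psi x)%:E)%E = (fun=> 0%E).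
    by apply/funext => n; exact: integral_simple_comp_eq0.
  have L := cvg_lim (@ereal_hausdorff R) cv.
  by rewrite -L E0 lim_cst//; exact: ereal_hausdorff.
apply: (@dominated_cvg _ _ _ P setT measurableT _ _
  (fun x => `|(k (g x) * psi x)%:E|%E)) => //.
- move=> n; apply/measurable_EFinP; apply: measurable_funM => //.
  exact: measurableT_comp.
- move=> x _; have := @cvg_nnsfun_approx _ _ _ setT measurableT _ mek.
  move=> /(_ _ (g x) I) cv.
  rewrite [X in X @ _ --> _](_ : _ = (fun n => (phi n (g x))%:E * (psi x)%:E)%E)//.
  by rewrite EFinM; apply: cvgeZr => //; apply: cv => y _; rewrite lee_fin.
- exact: integrable_abse.
- move=> n x _; rewrite !abse_EFin lee_fin !normrM ler_wpM2r//.
  by rewrite !ger0_norm.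
Qed.

(** The last hypothesis says that the conditional mean of [psi] given [g] is zero. The extension
    runs from simple functions of [g] to nonnegative ones by dominated convergence, then to positive
    and negative parts. *)
Lemma integral_mul_eq0 g psi :
  measurable_fun setT g -> P.-integrable setT (EFin \o psi) ->
  P.-integrable setT (fun x => (g x * psi x)%:E) ->
  (forall U, measurable U -> \int[P]_(x in g @^-1` U) (psi x)%:E = 0)%E ->
  (\int[P]_x (g x * psi x)%:E = 0)%E.
Proof.
move=> mg ipsi igpsi H0.
have mpsi : measurable_fun setT psi.
  by apply/measurable_EFinP; exact: (measurable_int P).
have mp : measurable_fun setT (fun x : R => Num.max x 0).
  by apply: measurable_maxr => //.
have mn : measurable_fun setT (fun x : R => Num.max (- x) 0).
  by apply: measurable_maxr => //.
have ip : P.-integrable setT (fun x => (Num.max (g x) 0 * psi x)%:E).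
  apply: (le_integrable measurableT _ _ igpsi).
    apply/measurable_EFinP; apply: measurable_funM => //.
    exact: (measurableT_comp mp).
  move=> x _; rewrite !abse_EFin lee_fin !normrM ler_wpM2r//.
  by rewrite maxEle; case: ifP => // _; rewrite normr0.
have in' : P.-integrable setT (fun x => (Num.max (- g x) 0 * psi x)%:E).
  apply: (le_integrable measurableT _ _ igpsi).
    apply/measurable_EFinP; apply: measurable_funM => //.
    exact: (measurableT_comp mn).
  move=> x _; rewrite !abse_EFin lee_fin !normrM ler_wpM2r//.
  by rewrite maxEle; case: ifP => // _; rewrite ?normr0 ?normrN.
rewrite (eq_integral (fun x => (Num.max (g x) 0 * psi x)%:E - (Num.max (- g x) 0 * psi x)%:E)%E); last first.
  move=> x _; rewrite -EFinB -mulrBl; congr ((_ * _)%:E).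
  by have := congr1 (fun h => h x) (funrposBneg g).
rewrite integralB//.
rewrite (integral_ge0_comp_eq0 _ mp mg ipsi ip H0); last first.
  by move=> x; rewrite le_max lexx orbT.
rewrite (integral_ge0_comp_eq0 _ mn mg ipsi in' H0) ?sube0//.
by move=> x; rewrite le_max lexx orbT.
Qed.

End uncorrelated.

(** * Gaussian increments independent of a sigma-algebra *)

Section gaussian_increment.
Context {R : realType} {disp : measure_display} {T : measurableType disp}.
Context {d : nat}.
Variables (P : probability T R) (G : set (set T)) (X : 'I_d -> T -> R) (h : R).
Hypothesis h0 : 0 < h.
Hypothesis sG : sigma_algebra setT G.
Hypothesis mG : G `<=` measurable.
Hypothesis mX : forall i, measurable_fun setT (X i).
Hypothesis lawX : forall (A : set T) (U : 'I_d -> set R),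
  G A -> (forall i, measurable (U i)) ->
  P (A `&` [set omega | forall i, U i (X i omega)]) =
  (P A * \prod_(i < d) normal_prob 0 (Num.sqrt h) (U i))%E.
Notation N := (normal_prob 0 (Num.sqrt h)).
Implicit Types (Y : T -> R) (A : set T) (U : set R) (f : R -> R).

(** Stated over the type generated by [G], so that the general closure properties of measurable
    functions apply to the sub-sigma-algebra. *)
Definition measurable_wrt Y :=
  @measurable_fun _ _ (g_sigma_algebraType G) R setT Y.

Lemma measurable_wrtP Y : measurable_wrt Y <->
  forall U, measurable U -> G (Y @^-1` U).
Proof.
have E : <<s G>> = G by exact: sigma_algebra_id.
split=> [mY U mU|H _ U mU].
  by have := mY measurableT U mU; rewrite setTI /measurable/= E.
by rewrite setTI /measurable/= E; exact: H.
Qed.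

Lemma measurable_wrt_fun Y : measurable_wrt Y -> measurable_fun setT Y.
Proof.
by move=> /measurable_wrtP H _ U mU; rewrite setTI; apply: mG; exact: H.
Qed.

Let GT : G setT.
Proof. by case: sG => G0 GD _; rewrite -(setD0 setT); exact: GD. Qed.

Let sh0 : 0 < Num.sqrt h. Proof. by rewrite sqrtr_gt0. Qed.

Let NT : N setT = 1%E. Proof. exact: (@probability_setT _ _ _ N). Qed.

Let mXU i U : measurable U -> measurable (X i @^-1` U).
Proof. by move=> mU; rewrite -[_ @^-1` _]setTI; exact: mX. Qed.

Let law1 i A U : G A -> measurable U -> P (A `&` X i @^-1` U) = (P A * N U)%E.
Proof.
move=> GA mU.
have -> : A `&` X i @^-1` U =
    A `&` [set omega | forall j, (if j == i then U else setT) (X j omega)].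
  congr (_ `&` _); apply/seteqP; split=> [x Ux j /=|x /(_ i)/=].
    by case: eqP => // ->.
  by rewrite eqxx.
rewrite (lawX (U := fun j => if j == i then U else setT) GA); last first.
  by move=> j; case: ifP.
rewrite (bigD1 i)//= eqxx big1 ?mule1// => j ji.
by rewrite (negbTE ji) NT.
Qed.

(** Coordinate [j] is independent even of events involving coordinate [i]; this makes the mixed
    second moments vanish. *)
Let law2 i j A U V : i != j -> G A -> measurable U -> measurable V ->
  P (A `&` X i @^-1` U `&` X j @^-1` V) = (P (A `&` X i @^-1` U) * N V)%E.
Proof.
move=> ij GA mU mV; rewrite [in RHS]law1//.
have -> : A `&` X i @^-1` U `&` X j @^-1` V =
    A `&` [set omega | forall k, (if k == i then U else if k == j then V else setT)
      (X k omega)].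
  rewrite -setIA; congr (_ `&` _); apply/seteqP; split=> [x [Ux Vx] k /=|x H].
    by case: eqP => [->//|_]; case: eqP => [->|].
  split; first by have := H i; rewrite eqxx.
  by have := H j; rewrite eq_sym (negbTE ij) eqxx.
rewrite (lawX (U := fun k => if k == i then U else if k == j then V else setT) GA).
  2: by move=> k; do 2 case: ifP => //.
rewrite (bigD1 i)//= eqxx (bigD1 j)/=; last by rewrite eq_sym.
rewrite eq_sym (negbTE ij) eqxx big1 ?mule1 ?muleA// => k /andP[ki kj].
by rewrite (negbTE ki) (negbTE kj) NT.
Qed.

Let mXi i := isMeasurableFun.Build _ _ T (measurableTypeR R) _ (mX i).
Let RVX i : {RV P >-> measurableTypeR R} := HB.pack (X i : T -> measurableTypeR R) (mXi i).

Let integral_law i (f : measurableTypeR R -> \bar R) :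
  (\int[distribution P (RVX i)]_x f x = \int[N]_x f x)%E.
Proof.
apply: eq_measure_integral => U mU _.
transitivity (P (setT `&` X i @^-1` U)); first by rewrite setTI.
by rewrite law1// probability_setT mul1e.
Qed.

Lemma integrable_increment i f : measurable_fun setT f ->
  (N).-integrable setT (EFin \o f) ->
  P.-integrable setT (fun x => (f (X i x))%:E).
Proof.
move=> mf /integrableP[_ foo].
have mnf : measurable_fun setT (fun x => `|(f x)%:E|%E).
  by apply: measurableT_comp => //; exact/measurable_EFinP.
apply/integrableP; split.
  by apply/measurable_EFinP; exact: measurableT_comp.
have E := @ge0_integral_distribution _ _ _ _ _ P (RVX i) _ mnf (fun y => abse_ge0 _).
rewrite integral_law in E.
by apply: le_lt_trans foo; rewrite le_eqVlt; apply/orP; left; apply/eqP/esym.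
Qed.

Lemma integral_increment i f : measurable_fun setT f ->
  (N).-integrable setT (EFin \o f) ->
  (\int[P]_x (f (X i x))%:E = \int[N]_x (f x)%:E)%E.
Proof.
move=> mf intf.
have mef : measurable_fun setT (fun x => (f x)%:E) by exact/measurable_EFinP.
have E := @integral_distribution _ _ _ _ _ P (RVX i) _ mef (integrable_increment i mf intf).
by rewrite integral_law in E.
Qed.

(* Only the product rule [P (A n {X i in U}) = P A * N U] is used, so that [A]
   may also carry information on the other coordinates. *)
Let integral_indep i f A : measurable A ->
  (forall U, measurable U -> P (A `&` X i @^-1` U) = (P A * N U)%E) ->
  measurable_fun setT f -> (N).-integrable setT (EFin \o f) ->
  (\int[N]_x (f x)%:E = 0)%E ->
  (\int[P]_(x in A) (f (X i x))%:E = 0)%E.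
Proof.
move=> mA lawA mf intf f0.
pose pA := fine (P A).
have PA : P A = pA%:E by rewrite fineK// fin_num_measure.
have ifX := integrable_increment i mf intf.
have mfX : measurable_fun setT (fun x => f (X i x)) by exact: measurableT_comp.
have iA : P.-integrable setT (EFin \o \1_A) by exact: integrable_indic.
have ipA : P.-integrable setT (EFin \o cst pA) by exact: finite_measure_integrable_cst.
have ipsi : P.-integrable setT (EFin \o (fun x => \1_A x - pA)).
  exact: (integrableB measurableT iA ipA).
have ifA : P.-integrable setT (fun x => (f (X i x) * \1_A x)%:E).
  apply: (le_integrable measurableT _ _ ifX).
    by apply/measurable_EFinP; apply: measurable_funM => //; exact: measurable_indic.
  move=> x _; rewrite !abse_EFin lee_fin normrM ler_piMr// indicE.
  by case: (x \in A); rewrite ?normr1 ?normr0.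
have ifpA : P.-integrable setT (fun x => (f (X i x) * pA)%:E).
  by under eq_fun do rewrite mulrC EFinM; exact: integrableZl.
(* The centred indicator integrates to zero over each event of [f (X i)], by the product rule;
   expanding this product leaves [pA] times the mean of [f], which is zero. *)
have E0 : (\int[P]_x (f (X i x) * (\1_A x - pA))%:E = 0)%E.
  apply: integral_mul_eq0 => //.
    under eq_fun do rewrite mulrBr EFinB.
    exact: integrableB.
  move=> U mU; set W := _ @^-1` U.
  have WE : W = X i @^-1` (f @^-1` U) by [].
  have mfU : measurable (f @^-1` U) by rewrite -[_ @^-1` _]setTI; exact: mf.
  have mW : measurable W by rewrite WE; exact: mXU.
  under eq_integral do rewrite EFinB.
  have iAW := integrableS measurableT mW (@subsetT _ _) iA.
  have ipAW := integrableS measurableT mW (@subsetT _ _) ipA.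
  rewrite integralB//.
  rewrite integral_indic// integral_cst//.
  have PW : P W = N (f @^-1` U).
    by have := law1 i GT mfU; rewrite setTI probability_setT mul1e.
  change (P (A `&` W) - pA%:E * P W = 0)%E.
  rewrite PW WE lawA// PA subee//.
  by rewrite fin_numM// fin_num_measure.
have := E0; under eq_integral do rewrite mulrBr EFinB.
rewrite integralB//.
under [X in (_ - X)%E]eq_integral do rewrite mulrC EFinM.
rewrite integralZl// integral_increment// f0 mule0 sube0 => <-.
rewrite [LHS]integral_mkcond; apply: eq_integral => x _.
by rewrite patchE indicE; case: (x \in A); rewrite ?mulr1 ?mulr0.
Qed.

Lemma integrable_bounded_mul Y (f : T -> R) : measurable_wrt Y ->
  (exists M, forall x, `|Y x| <= M) ->
  P.-integrable setT (EFin \o f) -> P.-integrable setT (fun x => (Y x * f x)%:E).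
Proof.
move=> mY [M YM] intf.
have mf : measurable_fun setT f by apply/measurable_EFinP; exact: (measurable_int P).
have iM : P.-integrable setT (fun x => (M * f x)%:E).
  by under eq_fun do rewrite EFinM; exact: integrableZl.
apply: (le_integrable measurableT _ _ iM).
  apply/measurable_EFinP; apply: measurable_funM => //.
  exact: measurable_wrt_fun.
move=> x _; rewrite !abse_EFin lee_fin !normrM ler_wpM2r//.
by apply: le_trans (YM x) _; exact: ler_norm.
Qed.

Lemma integral_bounded_mul_increment Y i f : measurable_wrt Y ->
  (exists M, forall x, `|Y x| <= M) ->
  measurable_fun setT f -> (N).-integrable setT (EFin \o f) ->
  (\int[N]_x (f x)%:E = 0)%E ->
  (\int[P]_x (Y x * f (X i x))%:E = 0)%E.
Proof.
move=> mY YM mf intf f0.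
have ifX := integrable_increment i mf intf.
apply: integral_mul_eq0 => //.
- exact: measurable_wrt_fun.
- exact: (integrable_bounded_mul mY YM).
- move=> U mU; have GU : G (Y @^-1` U) by move/measurable_wrtP : mY; apply.
  apply: integral_indep => //; first exact: mG.
  by move=> V mV; rewrite law1.
Qed.

Lemma integrable_increment_mul i j :
  P.-integrable setT (fun x => (X i x * X j x)%:E).
Proof.
have i2 k : P.-integrable setT (fun x => (X k x ^+ 2)%:E).
  apply: (@integrable_increment k (fun x => x ^+ 2)); first exact: measurable_funX.
  exact: integrable_normal_sqr.
have i12 : P.-integrable setT (fun x => (X i x ^+ 2 + X j x ^+ 2)%:E).
  by under eq_fun do rewrite EFinD; exact: integrableD.
apply: (le_integrable measurableT _ _ i12).
  by apply/measurable_EFinP; exact: measurable_funM.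
move=> x _; rewrite !abse_EFin lee_fin (ger0_norm (addr_ge0 _ _)) ?sqr_ge0//.
rewrite normrM -!(real_normK (num_real (X _ x))).
move: `|X i x| `|X j x| (normr_ge0 (X i x)) (normr_ge0 (X j x)) => a b a0 b0.
have := sqr_ge0 (a - b); have := mulr_ge0 a0 b0; rewrite sqrrB; lra.
Qed.

(** [integral_mul_eq0] is used twice: for [Y], which reduces the claim to an event [A] of [G], and
    then for [X i] on [A], which leaves the mean of [X j] on [A] and an event of [X i]. *)
Lemma integral_bounded_mul_increment2 Y i j : i != j -> measurable_wrt Y ->
  (exists M, forall x, `|Y x| <= M) ->
  (\int[P]_x (Y x * (X i x * X j x))%:E = 0)%E.
Proof.
move=> ij mY YM; apply: integral_mul_eq0.
- exact: measurable_wrt_fun.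
- exact: integrable_increment_mul.
- exact: (integrable_bounded_mul mY YM (integrable_increment_mul i j)).
move=> U mU; set A := _ @^-1` U.
have GA : G A by move/measurable_wrtP : mY; apply.
have mA : measurable A := mG GA.
have ij1 := integrable_increment_mul i j.
have iXj : P.-integrable setT (fun x => (X j x)%:E).
  by apply: (@integrable_increment j id) => //; exact: integrable_normal_id.
transitivity (\int[P]_x (X i x * (\1_A x * X j x))%:E)%E.
  rewrite [LHS]integral_mkcond; apply: eq_integral => x _.
  by rewrite patchE indicE; case: (x \in A); rewrite ?mul1r ?mul0r ?mulr0.
have m1 : measurable_fun setT (\1_A : T -> R) by exact: measurable_indic.
apply: integral_mul_eq0 => //.
- apply: (le_integrable measurableT _ _ iXj).
    by apply/measurable_EFinP; exact: measurable_funM.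
  move=> x _; rewrite !abse_EFin lee_fin normrM ler_piMl// indicE.
  by case: (x \in A); rewrite ?normr1 ?normr0.
- apply: (le_integrable measurableT _ _ ij1).
    by apply/measurable_EFinP; apply: measurable_funM => //; exact: measurable_funM.
  move=> x _; rewrite !abse_EFin lee_fin !normrM ler_wpM2l// ler_piMl// indicE.
  by case: (x \in A); rewrite ?normr1 ?normr0.
- move=> V mV.
  transitivity (\int[P]_(x in A `&` X i @^-1` V) (X j x)%:E)%E.
    rewrite [LHS]integral_mkcond [RHS]integral_mkcond.
    apply: eq_integral => x _; rewrite !patchE indicE in_setI.
    by case: (x \in A); case: (x \in _); rewrite ?mul1r ?mul0r.
  apply: (@integral_indep j id) => //.
  + by apply: measurableI => //; exact: mXU.
  + by move=> W mW; rewrite law2.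
  + exact: integrable_normal_id.
  + exact: integral_normal_id.
Qed.

End gaussian_increment.

(** * Measurability and integrability of functions of random vectors *)

Section measurable_rV.
Context {R : realType} {disp : measure_display} {T : measurableType disp}.
Context {d : nat}.

(** An open set is the countable union of the cubes with rational centre and radius [1/(k+1)] that
    it contains, and the preimage of a cube is a finite intersection over the coordinates. *)
Lemma measurable_fun_continuous_rV (g : 'rV[R]_d -> R) (w : T -> 'rV[R]_d) :
  continuous g -> (forall i, measurable_fun setT (fun x => w x ord0 i)) ->
  measurable_fun setT (g \o w).
Proof.
move=> cg mw; apply: (measurability _ (RGenOpens.measurableE R)).
move=> _ [_ [a [b ->] <-]]; rewrite setTI comp_preimage; set U := `]a, b[%classic.
have oO : open (g @^-1` U).
  by apply: open_comp => [x _|]; [exact: cg|exact: interval_open].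
pose bx (p : 'rV[rat]_d * nat) : set 'rV[R]_d :=
  [set x | forall i, `|x ord0 i - ratr (p.1 ord0 i)| < p.2.+1%:R^-1].
pose J := [set p | bx p `<=` g @^-1` U].
have -> : g @^-1` U = \bigcup_(p in J) bx p.
  apply/seteqP; split => [x Ox|x [p Jp /Jp]//].
  have /nbhs_ballP[r /= r0 rO] : nbhs x (g @^-1` U) by exact: open_nbhs_nbhs.
  (* A cube of radius [1/(k+1)] that contains [x] lies within [2/(k+1) < r] of [x]. *)
  pose k := Num.truncn (2 / r).
  have kr : 2 * k.+1%:R^-1 < r.
    by rewrite ltr_pdivrMr// mulrC -ltr_pdivrMr// truncnS_gt.
  have k0 : 0 < k.+1%:R^-1 :> R by rewrite invr_gt0.
  have /choice[q qP] : forall i : 'I_d, exists q : rat,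
      `|x ord0 i - ratr q| < k.+1%:R^-1.
    move=> i; have [|q] := @rat_in_itvoo R (x ord0 i - k.+1%:R^-1) (x ord0 i + k.+1%:R^-1).
      by rewrite ltrBlDr -addrA ltrDl addr_gt0.
    by rewrite in_itv/= -ltr_distl distrC; exists q.
  exists (\row_i q i, k); last by move=> i /=; rewrite mxE.
  move=> y yq; apply: rO; rewrite -ball_normE/=.
  apply: le_lt_trans kr; apply: rV_norm_le; first by rewrite mulr_ge0// ltW.
  move=> i; rewrite !mxE -(subrKA (ratr (q i))) (le_trans (ler_normD _ _))//.
  have := yq i; rewrite /= mxE => yqi; have xqi := qP i.
  rewrite [X in _ + X]distrC mulr_natl mulr2n; apply: lerD; exact: ltW.
rewrite preimage_bigcup.
have -> : \bigcup_(p in J) w @^-1` bx p =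
    \bigcup_p (if pselect (J p) then w @^-1` bx p else set0).
  apply/seteqP; split => [x [p Jp px]|x [p _]]; first by exists p => //; case: pselect.
  by case: pselect => [Jp px|nJ []]; exists p.
apply: countable_bigcupT_measurable => // p; case: pselect => [Jp|_ /=]; last exact: measurable0.
have -> : w @^-1` bx p = \bigcap_(i in [set: 'I_d])
    ((fun x => w x ord0 i) @^-1` [set r | `|r - ratr (p.1 ord0 i)| < p.2.+1%:R^-1]).
  by apply/seteqP; split => [x H i _|x H i]; exact: H.
apply: fin_bigcap_measurable => // i _.
rewrite -[X in measurable X]setTI; apply: mw => //.
set q := ratr _; set c := _^-1.
rewrite (_ : [set _ | _] = `]q - c, q + c[%classic)//.
by apply/seteqP; split => r; rewrite /= in_itv/= ltr_distl.
Qed.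

End measurable_rV.

Section integrable_box.
Context {R : realType} {disp : measure_display} {T : measurableType disp}.
Context {d : nat}.
Variable P : {finite_measure set T -> \bar R}.

Lemma integrable_indic_box (g : 'rV[R]_d -> R) (W : T -> 'rV[R]_d) (A : set T)
    (K : R) : continuous g ->
  (forall i, measurable_fun setT (fun x => W x ord0 i)) ->
  measurable A -> (forall x, A x -> `|W x| <= K) ->
  P.-integrable setT (EFin \o (fun x => \1_A x * g (W x))).
Proof.
move=> cg mW mA AK.
have [M M0 MP] := @box_bounded R d unit (fun _ => g) K (fun _ => cg).
apply: measurable_bounded_integrable => //.
- by rewrite fin_num_fun_lty//; exact: fin_num_measure.
- apply: measurable_funM; first exact: measurable_indic.
  exact: (measurable_fun_continuous_rV cg mW).
- exists M; split; first exact: num_real.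
  move=> r Mr x _ /=; apply: le_trans (ltW Mr).
  rewrite indicE normrM.
  have [/set_mem Ax|_] := boolP (x \in A); last by rewrite normr0 mul0r.
  by rewrite normr1 mul1r (MP tt)// AK.
Qed.

End integrable_box.

(** * One step of the scheme *)

Section step.
Context {R : realType} {disp : measure_display} {T : measurableType disp}.
Context {d : nat}.
Variables (P : probability T R) (G : set (set T)) (X : 'I_d -> T -> R) (h : R).
Hypothesis h0 : 0 < h.
Hypothesis sG : sigma_algebra setT G.
Hypothesis mG : G `<=` measurable.
Hypothesis mX : forall i, measurable_fun setT (X i).
Hypothesis lawX : forall (A : set T) (U : 'I_d -> set R),
  G A -> (forall i, measurable (U i)) ->
  P (A `&` [set omega | forall i, U i (X i omega)]) =
  (P A * \prod_(i < d) normal_prob 0 (Num.sqrt h) (U i))%E.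

Lemma Rintegral_sum_le (I : finType) (f : I -> T -> R) (c : I -> R) :
  (forall i, P.-integrable setT (EFin \o f i)) ->
  (forall i, \int[P]_x f i x <= c i) ->
  P.-integrable setT (EFin \o (fun x => \sum_i f i x)) /\
  \int[P]_x (\sum_i f i x) <= \sum_i c i.
Proof.
move=> intf fc.
have E : EFin \o (fun x => \sum_i f i x) = (fun x => \sum_i (f i x)%:E)%E.
  by apply/funext => x /=; rewrite sumEFin.
have ints : P.-integrable setT (fun x => \sum_i (f i x)%:E)%E.
  by apply: integrable_sum => // i _; exact: intf.
split; first by rewrite E.
rewrite /Rintegral (_ : (\int[P]_x _)%E = \sum_i (\int[P]_x f i x)%R%:E)%E; last first.
  rewrite -[LHS]/(\int[P]_x (EFin \o (fun x => \sum_i f i x)%R) x)%E E integral_sum//.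
  by apply: eq_bigr => i _; rewrite /Rintegral fineK//; exact: (integrable_fin_num measurableT (intf i)).
by rewrite sumEFin /=; exact: ler_sum.
Qed.

Let Rint_eq0 (f : T -> R) : (\int[P]_x (f x)%:E = 0)%E -> \int[P]_x f x <= 0.
Proof. by rewrite /Rintegral => ->. Qed.

Let sqh0 : 0 < Num.sqrt h. Proof. by rewrite sqrtr_gt0. Qed.
Let sqhE : Num.sqrt h ^+ 2 = h. Proof. by rewrite sqr_sqrtr// ltW. Qed.

Let integrable_sqr_incr i : P.-integrable setT (EFin \o (fun x => X i x ^+ 2)).
Proof.
apply: (integrable_increment sG mX lawX i (f := fun x => x ^+ 2)).
  exact: measurable_funX.
exact: integrable_normal_sqr.
Qed.

Let Rint_sqr_incr i : \int[P]_x (X i x ^+ 2) = h.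
Proof.
rewrite /Rintegral.
rewrite (integral_increment sG mX lawX i (f := fun x => x ^+ 2)).
- by rewrite integral_normal_sqr// sqhE.
- exact: measurable_funX.
- exact: integrable_normal_sqr.
Qed.

Let integrable_normal_expr4 :
  (normal_prob 0 (Num.sqrt h)).-integrable setT (EFin \o (fun x => x ^+ 4)).
Proof.
apply: (integrable_normal_poly4 (c := 1)) => // x.
by rewrite mul1r ger0_norm ?lerDr// exprn_even_ge0.
Qed.

Let integrable_expr4_incr i : P.-integrable setT (EFin \o (fun x => X i x ^+ 4)).
Proof. exact: (integrable_increment sG mX lawX i (f := fun x => x ^+ 4)). Qed.

Let Rint_expr4_incr i : \int[P]_x (X i x ^+ 4) <= @normal_moment4_cst R * h ^+ 2.
Proof.
rewrite /Rintegral.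
rewrite (integral_increment sG mX lawX i (f := fun x => x ^+ 4))//.
  rewrite -lee_fin fineK; last exact: (integrable_fin_num measurableT).
  by apply: le_trans (integral_normal_expr4 sqh0) _; rewrite (exprM _ 2 2) sqhE.
Qed.

(** [W] and [W'] stand for the solution at two successive grid times, [A] and [A'] for the good
    events there; [b] is the source from the drift and [del] the pathwise error per unit of time. *)
Variables (V : 'rV[R]_d -> R) (s K e del C lam b : R) (W W' : T -> 'rV[R]_d).
Variables (A A' : set T).
Let euler (x : 'rV[R]_d) := x - h *: grad V x.
Let z omega := euler (W omega) + Num.sqrt (2 * s) *: \row_i X i omega.
Hypotheses (s0 : 0 < s) (e0 : 0 <= e) (del0 : 0 <= del) (C0 : 0 <= C) (b0 : 0 <= b).
Hypotheses (V2 : C2 V) (V0 : forall x, 0 <= V x).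
Hypothesis drift : forall x, `|x| <= K -> `|euler x| <= K + 1 /\
  V (euler x) + h * s * laplacian V (euler x) <= (1 - lam * h) * V x + h * b.
Hypothesis taylor : forall x D, `|x| <= K + 1 ->
  0 <= taylor_bound V e C x D /\
  (`|x + D| <= K + 1 -> V (x + D) <= taylor_bound V e C x D).
Hypothesis mW : forall i, measurable_wrt G (fun omega => W omega ord0 i).
Hypothesis mW' : forall i, measurable_fun setT (fun omega => W' omega ord0 i).
Hypotheses (GA : G A) (AK : forall omega, A omega -> `|W omega| <= K).
Hypotheses (mA' : measurable A') (A'A : A' `<=` A).
Hypothesis A'K : forall omega, A' omega -> `|z omega| <= K + 1 /\
  V (W' omega) <= V (z omega) + h * del.

Let measurable_wrt_euler i :
  measurable_wrt G (fun omega => euler (W omega) ord0 i).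
Proof.
have [[_ _ cdV] _] := V2.
rewrite /measurable_wrt.
under eq_fun do rewrite !mxE.
apply: measurable_funB; first exact: mW.
apply: measurable_funM => //.
exact: (measurable_fun_continuous_rV (cdV i) mW).
Qed.

(** The indicator makes these coefficients bounded, since on [A] the gradient step stays in the
    larger box; they remain [G]-measurable. *)
Let coefA (g : 'rV[R]_d -> R) omega := \1_A omega * g (euler (W omega)).

Let measurable_coefA g : continuous g -> measurable_wrt G (coefA g).
Proof.
move=> cg; apply: measurable_funM.
  apply: measurable_indic.
  by rewrite /measurable/= sigma_algebra_id.
exact: (measurable_fun_continuous_rV cg measurable_wrt_euler).
Qed.

Let bounded_coefA g : continuous g -> exists M, forall x, `|coefA g x| <= M.
Proof.
move=> cg; have [M M0 MP] := @box_bounded R d unit (fun _ => g) (K + 1) (fun _ => cg).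
exists M => x; rewrite /coefA indicE normrM.
have [/set_mem Ax|_] := boolP (x \in A); last by rewrite normr0 mul0r.
by rewrite normr1 mul1r MP//; apply: (drift (AK Ax)).1.
Qed.

Let integrable_mulX (Y Q : T -> R) : measurable_wrt G Y ->
  (exists M, forall x, `|Y x| <= M) -> P.-integrable setT (EFin \o Q) ->
  P.-integrable setT (EFin \o (fun x => Y x * Q x)).
Proof. exact: (integrable_bounded_mul sG mG). Qed.

(** Pieces of the Taylor bound: [L] and the compensated [Q] have mean zero, the compensators in [Q]
    being what sums to [h * s] times the Laplacian. [S] gathers the error terms and, being
    nonnegative, needs no indicator. *)
Let L i omega := coefA (partial V i) omega * (Num.sqrt (2 * s) * X i omega).
Let Q ij omega := coefA (hess V ij.1 ij.2) omega *
  (s * (X ij.1 omega * X ij.2 omega - (ij.1 == ij.2)%:R * h)).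
Let S i omega := 2 * s * e * X i omega ^+ 2 + (2 * s) ^+ 2 * C * X i omega ^+ 4.
Let Z omega := (1 - lam * h) * (\1_A omega * V (W omega)) + h * (b + del).

Let cpV i : continuous (partial V i).
Proof. by have [[_ _ c] _] := V2; exact: c. Qed.

Let chV ij : continuous (hess V ij.1 ij.2).
Proof. by have [_ /(_ ij.1)[_ _ c]] := V2; exact: c. Qed.

Let integrable_X i : P.-integrable setT (EFin \o X i).
Proof.
apply: (integrable_increment sG mX lawX i (f := id)) => //.
exact: integrable_normal_id.
Qed.

Let LP i : P.-integrable setT (EFin \o L i) /\ \int[P]_x L i x <= 0.
Proof.
have mL := measurable_coefA (@cpV i); have bL := bounded_coefA (@cpV i).
split.
  apply: integrable_mulX => //.
  rewrite (_ : EFin \o _ = fun x : T => ((Num.sqrt (2 * s))%:E * (X i x)%:E)%E)//.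
  by apply: integrableZl => //; exact: integrable_X.
apply: Rint_eq0.
pose f x := Num.sqrt (2 * s) * x.
have mf : measurable_fun setT f by exact: measurable_funM.
have intf : (normal_prob 0 (Num.sqrt h)).-integrable setT (EFin \o f).
  rewrite (_ : EFin \o _ = fun x : R => ((Num.sqrt (2 * s))%:E * x%:E)%E)//.
  by apply: integrableZl => //; exact: integrable_normal_id.
have f0 : (\int[normal_prob 0 (Num.sqrt h)]_x (f x)%:E = 0)%E.
  under eq_integral do rewrite EFinM.
  rewrite integralZl//; last exact: integrable_normal_id.
  by rewrite integral_normal_id// mule0.
exact: (integral_bounded_mul_increment sG mG mX lawX i mL bL mf intf f0).
Qed.

Let QP ij : P.-integrable setT (EFin \o Q ij) /\ \int[P]_x Q ij x <= 0.
Proof.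
have mQ := measurable_coefA (@chV ij); have bQ := bounded_coefA (@chV ij).
case: ij mQ bQ => i j /= mQ bQ.
split.
  apply: integrable_mulX => //=.
  rewrite (_ : EFin \o _ = fun x : T => (s%:E *
    ((X i x * X j x)%:E - ((i == j)%:R * h)%:E))%E)//.
  apply: integrableZl => //; apply: integrableB => //.
    exact: (integrable_increment_mul h0 sG mX lawX).
  exact: finite_measure_integrable_cst.
apply: Rint_eq0.
(* On the diagonal [Q] is a bounded coefficient times a centred function of [X i]; off it the
   compensator is zero and the mixed moment vanishes. *)
have [ij|ij] := eqVneq i j.
  rewrite /Q/= -ij eqxx mul1r.
  under eq_integral do rewrite -expr2.
  have i2 := integrable_normal_sqr sqh0.
  have iB : (normal_prob 0 (Num.sqrt h)).-integrable setT
      (EFin \o (fun x => x ^+ 2 - h)).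
    rewrite (_ : EFin \o _ = ((EFin \o (fun x : R => x ^+ 2)%R) \- (EFin \o cst h))%E)//.
    by apply: integrableB => //; exact: finite_measure_integrable_cst.
  pose f x := s * (x ^+ 2 - h).
  have mf : measurable_fun setT f.
    by apply: measurable_funM => //; exact: measurable_funB.
  have intf : (normal_prob 0 (Num.sqrt h)).-integrable setT (EFin \o f).
    rewrite (_ : EFin \o _ = fun x : R => (s%:E * (x ^+ 2 - h)%:E)%E)//.
    exact: integrableZl.
  have f0 : (\int[normal_prob 0 (Num.sqrt h)]_x (f x)%:E = 0)%E.
    under eq_integral do rewrite EFinM.
    rewrite integralZl//.
    under eq_integral do rewrite EFinB.
    have E1 := integral_normal_sqr sqh0; rewrite sqhE in E1.
    have E2 : (\int[normal_prob 0 (Num.sqrt h)]_x cst h%:E x = h%:E)%E.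
      by rewrite integral_cst//= (@probability_setT _ _ _ (normal_prob 0 (Num.sqrt h))) mule1.
    have ic : (normal_prob 0 (Num.sqrt h)).-integrable setT (EFin \o cst h).
      exact: finite_measure_integrable_cst.
    have EB := integralB_EFin measurableT i2 ic.
    transitivity (s%:E * (h%:E - h%:E))%E; last by rewrite subee// mule0.
    congr (_ * _)%E; apply: etrans EB _.
    by congr (_ - _)%E; [exact: E1|exact: E2].
  rewrite -ij in mQ bQ.
  exact: (integral_bounded_mul_increment sG mG mX lawX i mQ bQ mf intf f0).
rewrite /Q/= (negbTE ij).
under eq_integral do rewrite mul0r subr0 mulrCA EFinM.
rewrite integralZl//; last first.
  by apply: integrable_mulX => //; exact: (integrable_increment_mul h0 sG mX lawX).
by rewrite (integral_bounded_mul_increment2 h0 sG mG mX lawX ij mQ bQ) mule0.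
Qed.

Let SP i : P.-integrable setT (EFin \o S i) /\
  \int[P]_x S i x <= 2 * s * e * h + (2 * s) ^+ 2 * C * (@normal_moment4_cst R * h ^+ 2).
Proof.
have i2 : P.-integrable setT (fun x => (2 * s * e * X i x ^+ 2)%:E).
  by under eq_fun do rewrite EFinM; apply: integrableZl => //; exact: integrable_sqr_incr.
have i4 : P.-integrable setT (fun x => ((2 * s) ^+ 2 * C * X i x ^+ 4)%:E).
  by under eq_fun do rewrite EFinM; apply: integrableZl => //; exact: integrable_expr4_incr.
split.
  rewrite (_ : EFin \o _ = (fun x => (2 * s * e * X i x ^+ 2)%:E
    + ((2 * s) ^+ 2 * C * X i x ^+ 4)%:E)%E)//.
  exact: integrableD.
rewrite /S RintegralD// !RintegralZl// Rint_sqr_incr lerD2l ler_wpM2l//.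
by rewrite mulr_ge0// sqr_ge0.
Qed.

Let integrable_AV : P.-integrable setT (EFin \o (fun x => \1_A x * V (W x))).
Proof.
have [[cV _ _] _] := V2.
apply: (@integrable_indic_box _ _ _ _ P V W A K) => //; last exact: mG.
by move=> i; exact: (measurable_wrt_fun sG mG (mW i)).
Qed.

Let pointwise omega : \1_A' omega * V (W' omega) <=
  Z omega + \sum_i L i omega + \sum_ij Q ij omega + \sum_i S i omega.
Proof.
have S0 : 0 <= \sum_i S i omega.
  apply: sumr_ge0 => i _; rewrite addr_ge0// mulr_ge0//.
  - by rewrite !mulr_ge0// ltW.
  - by rewrite sqr_ge0.
  - by rewrite mulr_ge0// sqr_ge0.
  - by rewrite exprn_even_ge0.
have hb : 0 <= h * (b + del) by rewrite mulr_ge0 ?addr_ge0// ltW.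
(* Off [A] the left side is zero, and the right side keeps only its nonnegative terms without
   indicator. *)
have [nA|nA] := pselect (A omega); last first.
  rewrite [\1_A' _]indicE memNset ?mul0r; last by move=> /A'A.
  rewrite /Z [\1_A _]indicE memNset// mul0r mulr0 add0r.
  rewrite big1; last by move=> i _; rewrite /L /coefA indicE memNset// !mul0r.
  rewrite big1; last by move=> i _; rewrite /Q /coefA indicE memNset// !mul0r.
  by rewrite !addr0 addr_ge0.
have WK := AK nA; have [eK dr] := drift WK.
have [tb0 tb] := taylor (Num.sqrt (2 * s) *: \row_i X i omega) eK.
have c2 : Num.sqrt (2 * s) ^+ 2 = 2 * s by rewrite sqr_sqrtr// mulr_ge0// ltW.
apply: (@le_trans _ _ (taylor_bound V e C (euler (W omega))
   (Num.sqrt (2 * s) *: \row_i X i omega) + h * del)).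
  (* On [A] but off [A'], nonnegativity of the Taylor bound is all that is needed. *)
  have [A'o|nA'] := pselect (A' omega).
    have [zK VW'] := A'K A'o.
    rewrite indicE mem_set// mul1r; apply: le_trans VW' _.
    by rewrite lerD2r; exact: tb.
  by rewrite indicE memNset// mul0r addr_ge0// mulr_ge0// ltW.
rewrite /taylor_bound /sqsum /Z indicE mem_set// mul1r.
have E1 : \sum_i (Num.sqrt (2 * s) *: \row_i X i omega) ord0 i * partial V i (euler (W omega))
    = \sum_i L i omega.
  by apply: eq_bigr => i _; rewrite /L /coefA indicE mem_set// mul1r !mxE mulrC.
have E3 : e * (\sum_i (Num.sqrt (2 * s) *: \row_i X i omega) ord0 i ^+ 2) +
   C * (\sum_i (Num.sqrt (2 * s) *: \row_i X i omega) ord0 i ^+ 4) = \sum_i S i omega.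
  rewrite !mulr_sumr -big_split/=; apply: eq_bigr => i _.
  rewrite !mxE !exprMn (exprM _ 2 2) c2 /S; ring.
have E2 : 2^-1 * (\sum_i \sum_j (Num.sqrt (2 * s) *: \row_i X i omega) ord0 i
     * (Num.sqrt (2 * s) *: \row_i X i omega) ord0 j * hess V i j (euler (W omega))) =
    \sum_ij Q ij omega + h * s * laplacian V (euler (W omega)).
  rewrite laplacianE.
  rewrite -(pair_bigA _ (fun i j => Q (i, j) omega))/= mulr_sumr [in RHS]mulr_sumr.
  rewrite -big_split/=; apply: eq_bigr => i _.
  rewrite [X in _ = _ + X](_ : _ =
    \sum_j (i == j)%:R * (h * s * hess V i j (euler (W omega)))); last first.
    rewrite (bigD1 i)//= eqxx mul1r big1 ?addr0// => j ji.
    by rewrite eq_sym (negbTE ji) mul0r.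
  rewrite mulr_sumr -big_split/=; apply: eq_bigr => j _.
  rewrite /Q /coefA indicE mem_set// !mxE/=.
  set x := X i omega; set y := X j omega; set H := hess _ _ _ _.
  set c := Num.sqrt _ in c2 *.
  transitivity (2^-1 * c ^+ 2 * (x * y * H)); first by ring.
  by rewrite c2; field.
rewrite E1 E2 -[X in X + h * del]addrA E3.
move: dr; set a := V (euler _); set l := h * s * _.
rewrite -subr_ge0 => dr; rewrite -subr_ge0.
rewrite (_ : _ - _ = (1 - lam * h) * V (W omega) + h * b - (a + l))//; ring.
Qed.

Lemma euler_step :
  \int[P]_x (\1_A' x * V (W' x)) <=
  (1 - lam * h) * \int[P]_x (\1_A x * V (W x)) +
  h * (b + del + d%:R * (2 * s) * e) +
  h ^+ 2 * (d%:R * (2 * s) ^+ 2 * C * @normal_moment4_cst R).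
Proof.
have [iL intL] := Rintegral_sum_le (fun i => (LP i).1) (fun i => (LP i).2).
have [iQ intQ] := Rintegral_sum_le (fun i => (QP i).1) (fun i => (QP i).2).
have [iS intS] := Rintegral_sum_le (fun i => (SP i).1) (fun i => (SP i).2).
have iZ1 : P.-integrable setT (EFin \o (fun x => (1 - lam * h) * (\1_A x * V (W x)))).
  by rewrite /comp; under eq_fun do rewrite EFinM; exact: integrableZl.
have iZ2 : P.-integrable setT (EFin \o cst (h * (b + del))).
  exact: finite_measure_integrable_cst.
have iZ : P.-integrable setT (EFin \o Z) by exact: (integrableD measurableT iZ1 iZ2).
have iZL := integrableD measurableT iZ iL.
have iZLQ := integrableD measurableT iZL iQ.
have iZLQS := integrableD measurableT iZLQ iS.
have [[cV _ _] _] := V2.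
have mVW' := measurable_fun_continuous_rV cV mW'.
have m1 : measurable_fun setT (fun x => \1_A' x * V (W' x)).
  by apply: measurable_funM => //; exact: measurable_indic.
have p0 x : 0 <= \1_A' x * V (W' x) by rewrite mulr_ge0// indicE.
have i1 : P.-integrable setT (EFin \o (fun x => \1_A' x * V (W' x))).
  apply: (le_integrable measurableT _ _ iZLQS); first exact/measurable_EFinP.
  move=> x _.
  change (`|(\1_A' x * V (W' x))%:E| <=
    `|(Z x + \sum_i L i x + \sum_ij Q ij x + \sum_i S i x)%R%:E|)%E.
  rewrite !abse_EFin lee_fin ger0_norm//.
  by apply: le_trans (pointwise x) _; exact: ler_norm.
apply: le_trans (le_Rintegral measurableT i1 iZLQS (fun x _ => pointwise x)) _.
rewrite (RintegralD measurableT iZLQ iS) (RintegralD measurableT iZL iQ).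
rewrite (RintegralD measurableT iZ iL) (RintegralD measurableT iZ1 iZ2).
have IZ2 : \int[P]_x (cst (h * (b + del)) x) = h * (b + del).
  rewrite /Rintegral -[X in fine X]/(\int[P]_x cst (h * (b + del))%:E x)%E.
  by rewrite integral_cst//= probability_setT mule1.
rewrite RintegralZl// IZ2.
move: intL intQ intS; rewrite !sumr_const !mul0rn !card_ord.
set I1 := \int[P]_x _; set I2 := \int[P]_x _; set I3 := \int[P]_x _.
rewrite -[_ *+ d]mulr_natl.
set I4 := \int[P]_x _; set m := normal_moment4_cst.
move=> *; lra.
Qed.

End step.

(** * Fatou's lemma for an iterated limit *)

Section liminf.
Context {R : realType}.
Local Open Scope ereal_scope.

Lemma limn_einf_le (u : (\bar R)^nat) c :
  (\forall n \near \oo, u n <= c) -> limn_einf u <= c.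
Proof.
move=> [N _ Nc]; rewrite limn_einf_lim; apply: lime_le; first exact: is_cvg_einfs.
apply: nearW => n; apply: (@le_trans _ _ (u (maxn n N))); last first.
  by apply: Nc; rewrite /= leq_maxr.
by apply: ereal_inf_lbound; exists (maxn n N) => //=; rewrite leq_maxl.
Qed.

Lemma limn_einf_near_cst (u : (\bar R)^nat) c :
  (\forall n \near \oo, u n = c) -> limn_einf u = c.
Proof.
move=> uc; have uc' : u n @[n --> \oo] --> c.
  by apply: cvg_near_cst; apply: filterS uc => n ->.
by rewrite is_cvg_limn_einfE; [exact: cvg_lim uc'|apply/cvg_ex; exists c].
Qed.

(** Both thresholds in [n] may depend on [k], so the inner limit is taken with [k] fixed and Fatou's
    lemma is applied once for each index. *)
Lemma fatou2 d (T : measurableType d) (mu : {measure set T -> \bar R})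
    (f : nat -> nat -> T -> \bar R) (g : T -> \bar R) c :
  (forall k n, measurable_fun setT (f k n)) -> (forall k n x, 0 <= f k n x) ->
  measurable_fun setT g -> (forall x, 0 <= g x) ->
  (forall k, \forall n \near \oo, \int[mu]_x f k n x <= c) ->
  {ae mu, forall x, \forall k \near \oo, \forall n \near \oo, f k n x = g x} ->
  \int[mu]_x g x <= c.
Proof.
move=> mf f0 mg g0 fc fg.
have einf0 (u : (\bar R)^nat) : (forall n, 0 <= u n) -> 0 <= limn_einf u.
  move=> u0; rewrite limn_einf_lim; apply: lime_ge; first exact: is_cvg_einfs.
  by apply: nearW => n; apply: le_ereal_inf_tmp => _ [m _ <-].
have meinf (v : nat -> T -> \bar R) : (forall n, measurable_fun setT (v n)) ->
    measurable_fun setT (fun x => limn_einf (v ^~ x)).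
  move=> mv; under eq_fun do rewrite limn_einf_lim.
  apply: (emeasurable_fun_cvg (fun n x => einfs (v ^~ x) n)).
    by move=> n; exact: measurable_fun_einfs.
  by move=> x _; exact: is_cvg_einfs.
pose F k x := limn_einf (f k ^~ x).
have mF k : measurable_fun setT (F k) by exact: meinf.
have F0 k x : 0 <= F k x by exact: einf0.
apply: (@le_trans _ _ (\int[mu]_x limn_einf (F ^~ x))).
  apply: ae_ge0_le_integral => //.
  - by move=> x _; exact: einf0.
  - exact: meinf.
  - apply: filterS fg => x fgx _.
    rewrite (limn_einf_near_cst (c := g x))//.
    by apply: filterS fgx => k; exact: limn_einf_near_cst.
apply: le_trans (fatou _ _ _ _) _ => //.
apply: limn_einf_le; apply: nearW => k.
apply: le_trans (fatou _ _ _ _) _ => //.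
exact: limn_einf_le.
Qed.

End liminf.

(** * Discrete Gronwall inequality *)

Section recurrence.
Context {R : realType}.

(* Since [1 - lam h <= exp (- lam h)], the constant [b exp (lam h) / lam] absorbs
   the source term [h b]: it suffices that [lam h <= exp (lam h) - 1]. *)
Lemma euler_gronwall (a : nat -> R) (lam h b : R) (n : nat) : 0 < lam -> 0 < h ->
  0 <= b -> (forall k, 0 <= a k) ->
  (forall k, (k < n)%N -> a k.+1 <= (1 - lam * h) * a k + h * b) ->
  a n <= expR (- lam * (n%:R * h)) * a 0%N
    + b * expR (lam * h) * ((1 - expR (- lam * (n%:R * h))) / lam).
Proof.
move=> lam0 h0 b0 a0 aS.
have q1 : 1 - lam * h <= expR (- lam * h).
  by have := expR_ge1Dx (- lam * h); rewrite mulNr.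
have hq : h * b <= b * expR (lam * h) / lam * (1 - expR (- lam * h)).
  have -> : b * expR (lam * h) / lam * (1 - expR (- lam * h)) =
      b * (expR (lam * h) - expR (lam * h) * expR (- lam * h)) / lam.
    by field; rewrite gt_eqF.
  rewrite -expRD mulNr subrr expR0 ler_pdivlMr// mulrAC mulrC ler_wpM2l//.
  by have := expR_ge1Dx (lam * h); lra.
suff H k : (k <= n)%N -> a k <= expR (- lam * (k%:R * h)) * a 0%N
    + b * expR (lam * h) * ((1 - expR (- lam * (k%:R * h))) / lam) by exact: H.
elim: k => [_|k IH kn].
  by rewrite mul0r mulr0 expR0 subrr mul0r mulr0 addr0 mul1r.
apply: le_trans (aS k kn) _.
(* Nonnegativity of [a k] permits this replacement whatever the sign of [1 - lam * h]. *)
apply: (@le_trans _ _ (expR (- lam * h) * a k + h * b)).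
  by rewrite lerD2r ler_wpM2r.
have := ler_wpM2l (expR_ge0 (- lam * h)) (IH (ltnW kn)).
move=> /(lerD)/(_ hq)/le_trans; apply.
have -> : expR (- lam * (k.+1%:R * h)) = expR (- lam * h) * expR (- lam * (k%:R * h)).
  by rewrite -expRD -natr1; congr expR; ring.
move: (expR (- lam * h)) (expR (- lam * (k%:R * h))) (expR (lam * h)) => q p r.
rewrite le_eqVlt; apply/orP; left; apply/eqP.
by field; rewrite gt_eqF.
Qed.

Lemma near_right0_divn (Q : R -> Prop) (t : R) : 0 < t ->
  (\forall h \near (0 : R)^'+, Q h) -> \forall n \near \oo, Q (t / n.+1%:R).
Proof.
move=> t0 QP; move: QP => /nbhs_ballP[r /= r0 rQ].
near=> n; apply: rQ; last by rewrite divr_gt0.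
rewrite -ball_normE/= sub0r normrN gtr0_norm ?divr_gt0// ltr_pdivrMr//.
rewrite -ltr_pdivrMl// mulrC; apply: (@lt_trans _ _ n%:R); last by rewrite ltr_nat.
by near: n; exact: nbhs_infty_gtr.
Unshelve. all: by end_near. Qed.

End recurrence.

(** * Subtraction of the minimum *)

Section shift.
Context {R : realType} {d : nat}.
Implicit Types (f : 'rV[R]_d -> R).

(** The difference quotients are equal as functions, so the total operator [derive] takes equal
    values without any differentiability assumption. *)
Let diff_quotient_subr_cst f (c : R) (x v : 'rV[R]_d) :
  (fun h : R => h^-1 *: (((fun y => f y - c) \o shift x) (h *: v) - (f x - c))) =
  (fun h : R => h^-1 *: ((f \o shift x) (h *: v) - f x)).
Proof. by apply/funext => h /=; rewrite opprB addrA subrK. Qed.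

Lemma partial_subr_cst f (c : R) i : partial (fun y => f y - c) i = partial f i.
Proof. by apply/funext => x; rewrite /partial /derive diff_quotient_subr_cst. Qed.

Lemma grad_subr_cst f (c : R) : grad (fun y => f y - c) = grad f.
Proof. by apply/funext => x; apply/rowP => i; rewrite !mxE partial_subr_cst. Qed.

Lemma laplacian_subr_cst f (c : R) : laplacian (fun y => f y - c) = laplacian f.
Proof.
apply/funext => x; rewrite /laplacian.
by apply: eq_bigr => i _; rewrite (partial_subr_cst f c i).
Qed.

Lemma C2_subr_cst f (c : R) : C2 f -> C2 (fun y => f y - c).
Proof.
move=> [[cf df cdf] f2]; split; last by move=> i; rewrite partial_subr_cst.
split.
- by move=> x; apply: (continuousB (cf x)); exact: cst_continuous.
- move=> i x; by rewrite /derivable diff_quotient_subr_cst; exact: df.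
- by move=> i; rewrite partial_subr_cst.
Qed.

End shift.

(** * Pathwise error of the predictor *)

Section pathwise.
Context {R : realType}.
Notation mu := (@lebesgue_measure R).

(** Freezing the path at its initial value for negative times makes it continuous on the whole
    line. *)
Lemma continuous_half_line_ext (U : topologicalType) (p : R -> U) :
  {within `[0, +oo[, continuous p} -> continuous (fun s : R => p (Num.max s 0)).
Proof.
move=> /subspace_continuousP cp s.
have s0 : `[0, +oo[%classic (Num.max s 0).
  by rewrite /= in_itv/= andbT le_max lexx orbT.
have cm : (fun x : R => Num.max x 0) @ s --> Num.max s 0.
  by apply: continuous_max => //; exact: cst_continuous.
move=> A /(cp _ s0) H.
have {}H : \forall y \near Num.max s 0, `[0, +oo[%classic y -> A (p y) by exact: H.
have : \forall x \near s, `[0, +oo[%classic (Num.max x 0) -> A (p (Num.max x 0)).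
  exact: cm H.
apply: filterS => x; apply.
by rewrite /= in_itv/= andbT le_max lexx orbT.
Qed.

(** Error of the left-endpoint rule on [[x, y]]; the integrals start at 0 as in the integral form of
    the equation. *)
Lemma Rintegral_increment_le (b : R -> R) (x y eta : R) : continuous b ->
  0 <= x -> x <= y -> (forall s, x <= s <= y -> `|b s - b x| <= eta) ->
  `|\int[mu]_(s in `[0, y]) b s - \int[mu]_(s in `[0, x]) b s - (y - x) * b x|
    <= (y - x) * eta.
Proof.
move=> cb x0 xy beta.
have ib (u v : R) : mu.-integrable `[u, v] (EFin \o b).
  apply: continuous_compact_integrable; first exact: segment_compact.
  exact: continuous_subspaceT.
have [<-|xney] := eqVneq x y; first by rewrite !subrr !mul0r subrr normr0.
have xlty : x < y by rewrite lt_neqAle xney.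
rewrite (@Rintegral_itvB _ b (BLeft 0) (BRight y) x) ?bnd_simp//.
have mxy : mu `]x, y] = (y - x)%:E.
  by rewrite lebesgue_measure_itv/= lte_fin xlty EFinB.
have ib' : mu.-integrable `]x, y] (EFin \o b).
  apply: integrableS (ib x y) => //.
  by apply: subset_itvr; rewrite bnd_simp.
have ic (c : R) : mu.-integrable `]x, y] (EFin \o cst c).
  have icc : mu.-integrable `[x, y] (EFin \o cst c).
    apply: continuous_compact_integrable; first exact: segment_compact.
    by apply: continuous_subspaceT => z; exact: cst_continuous.
  apply: integrableS icc => //.
  by apply: subset_itvr; rewrite bnd_simp.
have icst (c : R) : \int[mu]_(s in `]x, y]) (cst c s) = (y - x) * c.
  transitivity (c * fine (mu `]x, y])); last by rewrite mxy mulrC.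
  exact: Rintegral_cst.
rewrite -icst -RintegralB//.
have iB : mu.-integrable `]x, y] (EFin \o (fun s => b s - cst (b x) s)).
  rewrite (_ : EFin \o _ = ((EFin \o b) \- (EFin \o cst (b x)))%E)//.
  by apply: integrableB => //; exact: ic.
apply: le_trans (le_normr_Rintegral _ iB) _ => //.
rewrite -icst; apply: le_Rintegral => //.
- by have := integrable_norm iB.
- move=> s; rewrite /= in_itv/= => /andP[xs sy]; apply: beta.
  by rewrite (ltW xs).
Qed.

Variables (d : nat) (V : 'rV[R]_d -> R) (c : R) (p q : R -> 'rV[R]_d).
Hypothesis V1 : C1 V.
Hypothesis cp : {within `[0, +oo[, continuous p}.
Hypothesis pE : forall t, 0 <= t ->
  p t = p 0 - \row_(i < d) \int[mu]_(s in `[0, t]) (grad V (p s) ord0 i) + c *: q t.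

(** The noise is a row of coordinate differences in order to agree literally with the increments
    [X i] of the one-step estimate. *)
Definition euler_predictor (h : R) (x u v : 'rV[R]_d) :=
  x - h *: grad V x + c *: \row_(i < d) (v ord0 i - u ord0 i).

(** The additive noise cancels, and in each coordinate the difference is the left-endpoint error for
    the drift. *)
Lemma euler_path_error (x y eta : R) : 0 <= x -> x <= y -> 0 <= eta ->
  (forall i s, x <= s <= y -> `|partial V i (p s) - partial V i (p x)| <= eta) ->
  `|p y - euler_predictor (y - x) (p x) (q x) (q y)| <= (y - x) * eta.
Proof.
move=> x0 xy eta0 H; have y0 := le_trans x0 xy.
have [_ _ cdV] := V1.
apply: rV_norm_le; first by rewrite mulr_ge0// subr_ge0.
move=> i; rewrite /euler_predictor.
pose b s := partial V i (p (Num.max s 0)).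
have cb : continuous b.
  move=> s; apply: (@continuous_comp _ _ _ (fun s : R => p (Num.max s 0)) (partial V i)).
    exact: continuous_half_line_ext.
  exact: cdV.
have IE t : 0 <= t -> \int[mu]_(s in `[0, t]) (grad V (p s) ord0 i) =
    \int[mu]_(s in `[0, t]) b s.
  move=> t0; apply: eq_Rintegral => s /set_mem; rewrite /= in_itv/= => /andP[s0 _].
  by rewrite mxE /b max_l.
have bx : b x = partial V i (p x) by rewrite /b max_l.
have bnd s : x <= s <= y -> `|b s - b x| <= eta.
  move=> /[dup] xsy /andP[xs _].
  by rewrite bx /b max_l ?(le_trans x0)//; exact: H.
apply: le_trans (Rintegral_increment_le cb x0 xy bnd).
have yE := congr1 (fun v : 'rV[R]_d => v ord0 i) (pE y0).
have xE := congr1 (fun v : 'rV[R]_d => v ord0 i) (pE x0).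
rewrite !mxE !IE// in yE xE.
rewrite !mxE bx -normrN le_eqVlt; apply/orP; left; apply/eqP; congr `| _ |.
rewrite yE xE; ring.
Qed.

(* The bound [K] is taken first: the grid size needed depends on the modulus of
   continuity of the path and on the Lipschitz constant of [V] on the box [K+1]. *)
Lemma euler_path_near (t del : R) : 0 < t -> 0 < del ->
  \forall K \near \oo, \forall n \near \oo,
    forall k, (k <= n.+1)%N -> `|p (k%:R * (t / n.+1%:R))| <= K%:R /\
    ((k < n.+1)%N ->
      let z := euler_predictor (t / n.+1%:R) (p (k%:R * (t / n.+1%:R)))
        (q (k%:R * (t / n.+1%:R))) (q (k.+1%:R * (t / n.+1%:R))) in
      `|z| <= K%:R + 1 /\
      V (p (k.+1%:R * (t / n.+1%:R))) <= V z + t / n.+1%:R * del).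
Proof.
move=> t0 del0; have [_ _ cdV] := V1.
have cpp := continuous_half_line_ext cp.
have cseg : compact `[0, t]%classic by exact: segment_compact.
have [M M0 MP] := @compact_bounded_family R R unit
  (fun _ (s : R) => `|p (Num.max s 0)|) _ cseg (fun _ s => continuous_comp (cpp s) (@norm_continuous _ _ _)).
have pM s : 0 <= s <= t -> `|p s| <= M.
  move=> /andP[s0 st]; have := MP tt s; rewrite normr_id max_l// => H; apply: H.
  by rewrite /= in_itv/= s0.
near=> K.
have MK : M <= K%:R by near: K; exact: nbhs_infty_ger.
have [l l0 lP] := C1_box_lipschitz (K%:R + 1) V1.
(* The path error is at most [h * eta]; the Lipschitz constant [l] turns it into at most [h * del]
   for [V]. *)
pose eta := del / (l + 1).
have l1 : 0 < l + 1 by rewrite ltr_wpDl.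
have eta0 : 0 < eta by rewrite divr_gt0.
have leta : l * eta <= del.
  by rewrite /eta mulrCA ler_piMr ?(ltW del0)// ler_pdivrMr// mul1r lerDl.
have cg (i : 'I_d) : continuous (fun s : R => partial V i (p (Num.max s 0))).
  by move=> s; apply: (continuous_comp (cpp s)); exact: cdV.
have [r r0 rP] := compact_unif_continuous_family cseg cg eta0.
(* The second condition keeps the predictor in the box [K + 1]. *)
have hQ : \forall h \near (0 : R)^'+, h <= r /\ h * eta <= 1.
  near=> h; split.
    by near: h; exact: nbhs_right_ltW.
  rewrite -ler_pdivlMr// mul1r.
  by near: h; apply: nbhs_right_ltW; rewrite invr_gt0.
have := near_right0_divn t0 hQ; apply: filterS => n.
set h := t / n.+1%:R => -[hr heta1] k kn.
have h0 : 0 < h by rewrite divr_gt0.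
have tk (j : nat) : (j <= n.+1)%N -> 0 <= j%:R * h <= t.
  move=> jn; rewrite mulr_ge0 ?(ltW h0)//= /h mulrCA ler_piMr ?(ltW t0)//.
  by rewrite ler_pdivrMr// mul1r ler_nat.
have pK (j : nat) : (j <= n.+1)%N -> `|p (j%:R * h)| <= K%:R.
  by move=> /tk/pM/le_trans; exact.
split; first exact: pK.
move=> kn1; set z := euler_predictor _ _ _ _.
have /andP[x0 xt] := tk _ kn; have /andP[y0 yt] := tk _ kn1.
have yx : k.+1%:R * h - k%:R * h = h by rewrite -natr1; ring.
have xy : k%:R * h <= k.+1%:R * h by rewrite -subr_ge0 yx ltW.
have zE : `|p (k.+1%:R * h) - z| <= h * eta.
  have := @euler_path_error _ _ eta x0 xy (ltW eta0); rewrite yx; apply.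
  move=> i s /andP[xs sy]; have s0 := le_trans x0 xs.
  have := rP i (k%:R * h) s; rewrite !max_l// => rPi; rewrite distrC; apply: rPi.
    by rewrite /= in_itv/= x0.
  rewrite distrC ger0_norm ?subr_ge0//; apply: le_trans hr.
  by rewrite -[leRHS]yx lerD2r.
have zK : `|z| <= K%:R + 1.
  rewrite -[z](subrK (p (k.+1%:R * h))) addrC.
  apply: le_trans (ler_normD _ _) _; rewrite lerD ?pK// distrC.
  exact: le_trans heta1.
split => //; rewrite -lerBlDl.
apply: le_trans (ler_norm _) _; apply: le_trans (lP _ _ _ zK) _.
  by apply: le_trans (pK _ kn1) _; rewrite lerDl.
apply: (@le_trans _ _ (l * (h * eta))); first by rewrite ler_wpM2l.
by rewrite mulrCA ler_wpM2l// ltW.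
Unshelve. all: by end_near. Qed.

End pathwise.

Section sub_sigma_algebra.
Context {R : realType} {disp : measure_display} {T : measurableType disp}.
Implicit Types (G : set (set T)) (Y : T -> R).

Lemma sigma_algebra_setI G A B : sigma_algebra setT G -> G A -> G B -> G (A `&` B).
Proof.
move=> sG; rewrite -{1 2 3}(sigma_algebra_id sG).
exact: (@measurableI _ (g_sigma_algebraType G)).
Qed.

Lemma measurable_wrt_le G Y (r : R) : sigma_algebra setT G -> measurable_wrt G Y ->
  G [set x | Y x <= r].
Proof.
move=> sG /(measurable_wrtP sG) mY.
have -> : [set x | Y x <= r] = Y @^-1` `]-oo, r]%classic.
  by apply/seteqP; split => x; rewrite /= in_itv.
exact: mY.
Qed.

End sub_sigma_algebra.

(** * Good events and the localized recurrence *)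

Section langevin_scheme.
Context {R : realType} {disp : measure_display} {T : measurableType disp}.
Context {d : nat}.
Variables (P : probability T R) (F : R -> set (set T)) (B w : R -> T -> 'rV[R]_d).
Variables (V : 'rV[R]_d -> R) (s l1 l2 l3 : R).
Hypothesis hF : filtration F.
Hypothesis hB : brownian_motion P F B.
Hypothesis aw : adapted F w.
Hypothesis V2 : C2 V.
Hypothesis V0 : forall x, 0 <= V x.
Hypotheses (s0 : 0 < s) (l30 : 0 < l3) (sl : s * l2 < l1).
Hypothesis PL : forall x, l1 * V x <= enorm (grad V x) ^+ 2.
Hypothesis lapV : forall x, laplacian V x <= l2 * V x + l3.

Let lam := l1 - s * l2.
Let lam0 : 0 < lam. Proof. by rewrite subr_gt0. Qed.
Let cs := Num.sqrt (2 * s).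

Let sF t : 0 <= t -> sigma_algebra setT (F t).
Proof. by case: hF => + _ _; apply. Qed.

Let mF t : 0 <= t -> F t `<=` measurable.
Proof. by case: hF => _ + _; apply. Qed.

Let incF u t : 0 <= u -> u <= t -> F u `<=` F t.
Proof. by case: hF => _ _; apply. Qed.

Let adapted_wrt (Y : R -> T -> 'rV[R]_d) u t i : adapted F Y -> 0 <= u -> u <= t ->
  measurable_wrt (F t) (fun omega => Y u omega ord0 i).
Proof.
move=> aY u0 ut; have t0 := le_trans u0 ut.
apply/(measurable_wrtP (sF t0)) => U mU; apply: (incF u0 ut).
exact: aY.
Qed.

Lemma measurable_process t i : 0 <= t ->
  measurable_fun setT (fun omega => w t omega ord0 i).
Proof.
by move=> t0; apply: (measurable_wrt_fun (sF t0) (mF t0)); exact: adapted_wrt.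
Qed.

Section grid.
Variables (h K del : R).
Hypothesis h0 : 0 < h.
Let tk (k : nat) := k%:R * h.
Let tk0 k : 0 <= tk k. Proof. by rewrite mulr_ge0// ltW. Qed.
Let tkS k : tk k.+1 - tk k = h. Proof. by rewrite /tk -natr1; ring. Qed.
Let tk_lt k : tk k < tk k.+1. Proof. by rewrite -subr_gt0 tkS. Qed.

Definition predictor (k : nat) omega :=
  euler_predictor V cs h (w (tk k) omega) (B (tk k) omega) (B (tk k.+1) omega).

(** The recursion makes the events decrease by construction, and each condition is a sublevel set of
    a measurable function. *)
Fixpoint good_event (k : nat) : set T :=
  if k is j.+1 then
    good_event j `&` ([set omega | `|w (tk j.+1) omega| <= K] `&`
      ([set omega | `|predictor j omega| <= K + 1] `&`
       [set omega | V (w (tk j.+1) omega) - V (predictor j omega) <= h * del]))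
  else [set omega | `|w (tk 0) omega| <= K].

Lemma good_eventP (n : nat) omega :
  (forall k, (k <= n)%N -> `|w (tk k) omega| <= K /\
    ((k < n)%N -> `|predictor k omega| <= K + 1 /\
       V (w (tk k.+1) omega) <= V (predictor k omega) + h * del)) ->
  good_event n omega.
Proof.
elim: n => [H|n IH H] /=; first exact: (H 0%N _).1.
split.
  apply: IH => k kn; have [H1 H2] := H k (leqW kn); split => // kn'.
  by apply: H2; exact: ltn_trans kn' _.
split; first exact: (H n.+1 (leqnn _)).1.
have [_ /(_ (ltnSn n))[H1 H2]] := H n (leqnSn n).
by split => //=; rewrite lerBlDl.
Qed.

Let measurable_predictor k i :
  measurable_wrt (F (tk k.+1)) (fun omega => predictor k omega ord0 i).
Proof.
have [aB _ _ _] := hB; have [[_ _ cdV] _] := V2.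
have mw j : measurable_wrt (F (tk k.+1)) (fun omega => w (tk k) omega ord0 j).
  by apply: adapted_wrt => //; exact: ltW.
rewrite /measurable_wrt /predictor /euler_predictor.
under eq_fun do rewrite !mxE.
apply: measurable_funD.
  apply: measurable_funB; first exact: mw.
  apply: measurable_funM => //.
  exact: (measurable_fun_continuous_rV (cdV i) mw).
apply: measurable_funM => //; apply: measurable_funB.
  by apply: adapted_wrt.
by apply: adapted_wrt => //; exact: ltW.
Qed.

(** The predictor of index [j] uses the Brownian motion at time [tk j.+1], so it may only enter the
    event of index [j.+1]. *)
Lemma good_event_F k : F (tk k) (good_event k).
Proof.
have [[cV _ _] _] := V2.
have normF j : F (tk j) [set omega | `|w (tk j) omega| <= K].
  apply: (measurable_wrt_le _ (sF (tk0 j))).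
  apply: (@measurable_fun_continuous_rV _ _ (g_sigma_algebraType _) _ (fun x => `|x|)).
    exact: norm_continuous.
  by move=> i; exact: adapted_wrt.
elim: k => [|k IH]; first exact: normF.
have sk := sF (tk0 k.+1).
apply: sigma_algebra_setI => //; first exact: (incF (tk0 k) (ltW (tk_lt k))).
apply: sigma_algebra_setI => //.
apply: sigma_algebra_setI => //.
  apply: (measurable_wrt_le _ sk).
  apply: (@measurable_fun_continuous_rV _ _ (g_sigma_algebraType _) _ (fun x => `|x|)).
    exact: norm_continuous.
  exact: measurable_predictor.
apply: (measurable_wrt_le _ sk); apply: measurable_funB.
  apply: (measurable_fun_continuous_rV cV) => i; exact: adapted_wrt.
by apply: (measurable_fun_continuous_rV cV) => i; exact: measurable_predictor.
Qed.

Variables (e C : R).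
Hypotheses (e0 : 0 <= e) (del0 : 0 <= del) (C0 : 0 <= C).
Hypothesis drift : forall x, `|x| <= K ->
  `|x - h *: grad V x| <= K + 1 /\
  V (x - h *: grad V x) + h * s * laplacian V (x - h *: grad V x)
    <= V x - h * enorm (grad V x) ^+ 2 + h * s * laplacian V x + h * e.
Hypothesis taylor : forall x D, `|x| <= K + 1 ->
  0 <= taylor_bound V e C x D /\
  (`|x + D| <= K + 1 -> V (x + D) <= taylor_bound V e C x D).

(** Only [s * l3] survives in the limit. The errors come, in order, from the gradient step, the
    pathwise comparison, the quadratic Taylor remainder and the quartic term. *)
Definition scheme_source : R :=
  s * l3 + e + del + d%:R * (2 * s) * e +
  h * (d%:R * (2 * s) ^+ 2 * C * @normal_moment4_cst R).

Let a k := \int[P]_omega (\1_(good_event k) omega * V (w (tk k) omega)).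

Let a_step k : a k.+1 <= (1 - lam * h) * a k + h * scheme_source.
Proof.
have [aB _ _ lawB] := hB.
pose X i omega := B (tk k.+1) omega ord0 i - B (tk k) omega ord0 i.
have mX i : measurable_fun setT (X i).
  have sk := sF (tk0 k.+1); have mk := mF (tk0 k.+1).
  apply: measurable_funB.
    by apply: (measurable_wrt_fun sk mk); exact: adapted_wrt.
  by apply: (measurable_wrt_fun sk mk); apply: adapted_wrt => //; exact: ltW.
have lawX (A : set T) (U : 'I_d -> set R) : F (tk k) A ->
    (forall i, measurable (U i)) ->
    P (A `&` [set omega | forall i, U i (X i omega)]) =
    (P A * \prod_(i < d) normal_prob 0 (Num.sqrt h) (U i))%E.
  by move=> FA mU; rewrite (lawB _ _ (tk0 k) (tk_lt k) _ _ FA mU) tkS.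
(* Here the gradient inequality contributes [- l1 * h * V] and the Laplacian bound [s * l2 * h * V];
   together they give the rate [lam]. *)
have dr x : `|x| <= K -> `|x - h *: grad V x| <= K + 1 /\
    V (x - h *: grad V x) + h * s * laplacian V (x - h *: grad V x) <=
    (1 - lam * h) * V x + h * (s * l3 + e).
  move=> /drift[xK1 H]; split => //; apply: le_trans H _.
  have H1 := ler_wpM2l (ltW h0) (PL x).
  have hs : 0 <= h * s by rewrite mulr_ge0// ltW.
  have H2 := ler_wpM2l hs (lapV x).
  apply: (@le_trans _ _ (V x - h * (l1 * V x) + h * s * (l2 * V x + l3) + h * e)).
    by rewrite lerD2r lerD// lerD2l lerN2.
  by rewrite le_eqVlt; apply/orP; left; apply/eqP; rewrite /lam; ring.
have mA' : measurable (good_event k.+1).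
  by apply: (mF (tk0 k.+1)); exact: good_event_F.
have b0 : 0 <= s * l3 + e.
  by apply: addr_ge0 => //; apply: mulr_ge0; exact: ltW.
have AK omega : good_event k omega -> `|w (tk k) omega| <= K.
  by case: (k) => [|j] //= [_ []].
have A'A : good_event k.+1 `<=` good_event k by move=> omega [].
have A'K omega : good_event k.+1 omega -> `|predictor k omega| <= K + 1 /\
    V (w (tk k.+1) omega) <= V (predictor k omega) + h * del.
  by move=> [_ [_ [/= zK]]]; rewrite lerBlDl => Vz.
have := euler_step h0 (sF (tk0 k)) (mF (tk0 k)) mX lawX s0 e0 del0 C0 b0 V2 V0 dr
  taylor (fun i => adapted_wrt i aw (tk0 k) (lexx _))
  (fun i => measurable_process i (tk0 k.+1)) (good_event_F k) AK mA' A'A A'K.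
move=> /le_trans; apply; rewrite /scheme_source le_eqVlt; apply/orP; left; apply/eqP.
by rewrite -/(a k); move: (a k) normal_moment4_cst => p m; ring.
Qed.

Lemma good_event_decay (n : nat) :
  \int[P]_omega (\1_(good_event n) omega * V (w (n%:R * h) omega)) <=
  expR (- lam * (n%:R * h)) *
    \int[P]_omega (\1_(good_event 0) omega * V (w 0 omega)) +
  scheme_source * expR (lam * h) * ((1 - expR (- lam * (n%:R * h))) / lam).
Proof.
have b0 : 0 <= scheme_source.
  have m0 : 0 <= @normal_moment4_cst R by rewrite mulr_ge0// expR_ge0.
  have s20 : 0 <= 2 * s by rewrite mulr_ge0// ltW.
  have ds : 0 <= d%:R * (2 * s) * e by apply: mulr_ge0 => //; exact: mulr_ge0.
  have sl3 : 0 <= s * l3 by apply: mulr_ge0; exact: ltW.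
  have hC : 0 <= h * (d%:R * (2 * s) ^+ 2 * C * @normal_moment4_cst R).
    apply: mulr_ge0; first exact: ltW.
    by apply: mulr_ge0 => //; apply: mulr_ge0 => //; apply: mulr_ge0 => //; exact: sqr_ge0.
  by rewrite /scheme_source; do 4 (apply: addr_ge0 => //).
have a0 k : 0 <= a k by apply: Rintegral_ge0 => omega _; rewrite mulr_ge0.
have := euler_gronwall lam0 h0 b0 a0 (fun k (_ : (k < n)%N) => a_step k).
by rewrite /a /tk mul0r.
Qed.

End grid.
End langevin_scheme.

(** * Passage to the limit *)

Section langevin_decay.
Context {R : realType} {disp : measure_display} {T : measurableType disp}.
Context {d : nat}.
Variables (P : probability T R) (F : R -> set (set T)) (B w : R -> T -> 'rV[R]_d).
Variables (V : 'rV[R]_d -> R) (s l1 l2 l3 : R).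
Hypothesis hF : filtration F.
Hypothesis hB : brownian_motion P F B.
Hypothesis aw : adapted F w.
Hypothesis V2 : C2 V.
Hypothesis V0 : forall x, 0 <= V x.
Hypotheses (s0 : 0 < s) (l30 : 0 < l3) (sl : s * l2 < l1).
Hypothesis PL : forall x, l1 * V x <= enorm (grad V x) ^+ 2.
Hypothesis lapV : forall x, laplacian V x <= l2 * V x + l3.
Hypothesis cw : ae_continuous_paths P w.
Hypothesis wE : {ae P, forall omega, forall t : R, 0 <= t ->
  w t omega = w 0 omega
    - \row_(i < d) \int[lebesgue_measure]_(u in `[0, t]) (grad V (w u omega) ord0 i)
    + Num.sqrt (2 * s) *: B t omega}.
Hypothesis E0 : (\int[P]_omega (V (w 0 omega))%:E < +oo)%E.

Let lam := l1 - s * l2.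

Lemma langevin_decay (t : R) : 0 < t ->
  (\int[P]_omega (V (w t omega))%:E <=
   (expR (- lam * t) * \int[P]_omega V (w 0 omega)
    + s * l3 * ((1 - expR (- lam * t)) / lam))%:E)%E.
Proof.
move=> t0; have lam0 : 0 < lam by rewrite subr_gt0.
have [[cV cdV1 cdV] V2'] := V2; have V1 : C1 V by case: V2.
have mV u : 0 <= u -> measurable_fun setT (fun omega => V (w u omega)).
  move=> u0; apply: (measurable_fun_continuous_rV cV) => i.
  exact: (measurable_process hF aw).
have iV0 : P.-integrable setT (EFin \o (fun omega => V (w 0 omega))).
  apply/integrableP; split; first by apply/measurable_EFinP; exact: mV.
  by under eq_integral do rewrite /= ger0_norm//.
(* [kappa] is the total coefficient of [rho] in the source once [e] and [del] both equal [rho];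
   these errors then use half of [eta * lam]. *)
apply/lee_addgt0Pr => eta eta0.
pose kappa := 2 + d%:R * (2 * s).
have kappa0 : 0 < kappa.
  by rewrite /kappa ltr_pwDl// mulr_ge0// mulr_ge0// ltW.
pose rho := eta * lam / 2 / kappa.
have rho0 : 0 < rho by rewrite !divr_gt0// mulr_gt0.
(* After [n.+1] steps of this mesh the grid ends exactly at [t]. *)
pose h (n : nat) := t / n.+1%:R.
have h0 n : 0 < h n by rewrite divr_gt0.
have nh n : n.+1%:R * h n = t by rewrite /h mulrC divfK.
pose f k n omega : \bar R :=
  (\1_(good_event B w V s (h n) k%:R rho n.+1) omega * V (w t omega))%:E.
have mgood k n : measurable (good_event B w V s (h n) k%:R rho n.+1).
  have [_ mF _] := hF; apply: (mF (n.+1%:R * h n)); first by rewrite nh ltW.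
  exact: (good_event_F s hF hB aw V2 k%:R rho (h0 n) n.+1).
rewrite -EFinD.
apply: (@fatou2 R _ _ P f (fun omega => (V (w t omega))%:E)).
- move=> k n; apply/measurable_EFinP; apply: measurable_funM.
    exact: measurable_indic.
  by apply: mV; exact: ltW.
- by move=> k n omega; rewrite lee_fin mulr_ge0.
- by apply/measurable_EFinP; apply: mV; exact: ltW.
- by move=> omega; rewrite lee_fin.
- move=> k; set K : R := k%:R.
  have [C C0 CP] := taylor_bound_box (K + 1) V2 V0 rho0.
  have driftK := euler_drift_le K V2 (ltW s0) rho0.
  pose c := d%:R * (2 * s) ^+ 2 * C * @normal_moment4_cst R.
  (* The other half of [eta * lam] absorbs the quartic cost [u * c] and the factor [expR (lam * u)],
     which tend to 0 and 1. The constant [c] depends on [K], which is fixed here. *)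
  have srcK : \forall u \near (0 : R)^'+,
      (s * l3 + eta * lam / 2 + u * c) * expR (lam * u) <= s * l3 + eta * lam.
    pose G (u : R) := (s * l3 + eta * lam / 2 + u * c) * expR (lam * u).
    have cG : G u @[u --> 0] --> G 0.
      apply: cvgM.
        by apply: cvgD; [exact: cvg_cst|apply: cvgM; [exact: cvg_id|exact: cvg_cst]].
      apply: (@continuous_comp _ _ _ (fun u => lam * u) expR); last exact: continuous_expR.
      by apply: cvgM; [exact: cvg_cst|exact: cvg_id].
    have G0 : G 0 < s * l3 + eta * lam.
      rewrite /G mulr0 expR0 mulr1 mul0r addr0 ltrD2l ltr_pdivrMr//.
      by rewrite ltr_pMr ?mulr_gt0// ltr1n.
    have H : \forall u \near (0 : R)^'+, G u < s * l3 + eta * lam.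
      by apply: cvg_within; exact: (cvgr_lt _ cG).
    by apply: filterS H => u /ltW.
  apply: filterS2 (near_right0_divn t0 driftK) (near_right0_divn t0 srcK) => n dr src.
  have := good_event_decay hF hB aw V2 V0 s0 l30 sl PL lapV (h0 n) (ltW rho0)
    (ltW rho0) C0 dr CP n.+1.
  rewrite nh => H.
  have igood : P.-integrable setT (f k n).
    apply: (@integrable_indic_box _ _ _ _ P V (w t) _ K cV _ (mgood k n)) => [i|omega].
      by apply: (measurable_process hF aw); exact: ltW.
    by rewrite /good_event => -[_ []] /=; rewrite -/(h n) nh.
  rewrite -[leLHS]fineK; last exact: (integrable_fin_num measurableT igood).
  rewrite lee_fin; apply: le_trans H _.
  have e1 : expR (- lam * t) <= 1.
    by rewrite -expR0 ler_expR mulNr oppr_le0 mulr_ge0// ltW.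
  have q0 : 0 <= (1 - expR (- lam * t)) / lam by rewrite divr_ge0 ?subr_ge0// ltW.
  have g0 : \int[P]_omega (\1_(good_event B w V s (h n) K rho 0) omega * V (w 0 omega))
      <= \int[P]_omega V (w 0 omega).
    have mg0 : measurable (good_event B w V s (h n) K rho 0).
      have [_ mF _] := hF; apply: (mF (0%:R * h n)); first by rewrite mul0r.
      exact: (good_event_F s hF hB aw V2 K rho (h0 n) 0%N).
    have le0 omega : \1_(good_event B w V s (h n) K rho 0) omega * V (w 0 omega) <= V (w 0 omega).
      by rewrite ler_piMl// indicE; case: (_ \in _).
    apply: le_Rintegral => //.
    apply: (le_integrable measurableT _ _ iV0).
      apply/measurable_EFinP; apply: measurable_funM; first exact: measurable_indic.
      exact: mV.
    by move=> omega _; rewrite /= lee_fin !ger0_norm// mulr_ge0.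
  have srcE : scheme_source (d := d) s l3 (h n) rho rho C =
      s * l3 + eta * lam / 2 + h n * c.
    rewrite /scheme_source -/c -/kappa; congr (_ + _).
    rewrite (_ : eta * lam / 2 = rho * kappa); last by rewrite /rho divfK ?gt_eqF.
    by rewrite /kappa; ring.
  rewrite srcE.
  apply: (@le_trans _ _ (expR (- lam * t) * \int[P]_omega V (w 0 omega)
     + (s * l3 + eta * lam) * ((1 - expR (- lam * t)) / lam))).
    by rewrite lerD ?ler_wpM2l ?ler_wpM2r ?expR_ge0.
  rewrite -addrA lerD2l mulrDl lerD2l.
  rewrite (_ : eta * lam * _ = eta * (1 - expR (- lam * t))).
    by rewrite ler_piMr ?(ltW eta0)// gerBl expR_ge0.
  by field; rewrite gt_eqF.
(* Once a path lies in the good event, [f k n] equals the limit, so the convergence required is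
   eventual equality. *)
- move: cw wE; apply: filterS2 => omega cwo wEo.
  have := euler_path_near V1 cwo wEo t0 rho0; apply: filterS => k.
  apply: filterS => n H; rewrite /f indicE mem_set ?mul1r//.
  by apply: good_eventP => j jn; exact: H.
Qed.

End langevin_decay.

Theorem proposition7 (R : realType) :
  exists C : R, 0 < C /\
  forall (d : nat) (L : 'rV[R]_d -> R) (Lstar l1 l2 l3 : R) (H : R -> R)
    (sigma : R)
    (disp : measure_display) (T : measurableType disp) (P : probability T R)
    (F : R -> set (set T)) (B w : R -> T -> 'rV[R]_d),
  (0 < d)%N ->
  C2 L ->
  is_minimum L Lstar ->
  0 < l1 -> 0 < l2 -> 0 < l3 ->
  (forall x : R, 0 <= x -> 0 <= H x) ->
  {within `[0, +oo[, continuous H} ->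
  (forall v, L v - Lstar <= l1^-1 * enorm (grad L v) ^+ 2) ->
  (forall v, `|laplacian L v| <= l2 * (L v - Lstar) + l3) ->
  (forall v, enorm (grad L v) <= H (L v - Lstar)) ->
  0 < sigma ->
  sigma * l2 < l1 ->
  filtration F ->
  brownian_motion P F B ->
  unique_langevin_solution P F B L sigma w ->
  (forall t : R, 0 <= t ->
    ('E_P[fun omega => (L (w t omega) - Lstar)%R] <=
     'E_P[fun omega => (L (w 0%R omega) - Lstar)%R]
       * (expR (- (l1 - sigma * l2) * t))%:E
     + (sigma * l3 * ((1 - expR (- (l1 - sigma * l2) * t))
                      / (l1 - sigma * l2)))%:E)%E)
  /\
  (('E_P[fun omega => (L (w 0%R omega) - Lstar)%R] < +oo)%E ->
   \forall t \near +oo%R,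
    ('E_P[fun omega => (L (w t omega) - Lstar)%R] <=
     (C * ((sigma * l3) / (l1 - sigma * l2)))%:E)%E).
Proof.
exists 2; split => // d L Lstar l1 l2 l3 H sigma disp T P F B w _ L2 [_ Lmin].
move=> l10 l20 l30 _ _ HPL Hlap _ sigma0 sl hF hB [[aw cw wE] _].
pose V v := L v - Lstar.
set lam := l1 - sigma * l2.
have lam0 : 0 < lam by rewrite subr_gt0.
have V2 : C2 V by exact: C2_subr_cst.
have V0 v : 0 <= V v by rewrite subr_ge0.
have gV : grad V = grad L by exact: grad_subr_cst.
have PL v : l1 * V v <= enorm (grad V v) ^+ 2.
  by rewrite gV -ler_pdivlMl//; exact: HPL.
have lapV v : laplacian V v <= l2 * V v + l3.
  rewrite (laplacian_subr_cst L Lstar); apply: le_trans (Hlap v).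
  exact: ler_norm.
have EE t : ('E_P[fun omega => (L (w t omega) - Lstar)%R])%E =
    (\int[P]_omega (V (w t omega))%:E)%E by rewrite unlock.
have wE' : {ae P, forall omega, forall t : R, 0 <= t ->
  w t omega = w 0 omega
    - \row_(i < d) \int[lebesgue_measure]_(u in `[0, t]) (grad V (w u omega) ord0 i)
    + Num.sqrt (2 * sigma) *: B t omega} by rewrite gV.
have pos t : (0 <= \int[P]_omega (V (w t omega))%:E)%E.
  by apply: integral_ge0 => omega _; rewrite lee_fin.
have fineE : (\int[P]_omega (V (w 0 omega))%:E < +oo)%E ->
    (\int[P]_omega V (w 0 omega))%:E = (\int[P]_omega (V (w 0 omega))%:E)%E.
  by move=> E0; rewrite fineK// ge0_fin_numE.
split.
  move=> t t0; rewrite !EE.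
  (* With infinite initial mean the right side is infinite, because the exponential factor is
     positive. *)
  have [E0|] := ltP (\int[P]_omega (V (w 0 omega))%:E)%E +oo%E; last first.
    rewrite leye_eq => /eqP ->.
    by rewrite gt0_mulye ?lte_fin ?expR_gt0// addye// leey.
  have [<-|tn0] := eqVneq 0 t.
    by rewrite mulr0 expR0 subrr mul0r mulr0 mule1 adde0.
  have tgt0 : 0 < t by rewrite lt_neqAle tn0.
  have := langevin_decay hF hB aw V2 V0 sigma0 l30 sl PL lapV cw wE' E0 tgt0.
  by rewrite EFinD EFinM fineE// muleC.
rewrite EE => E0.
set m := \int[P]_omega V (w 0 omega).
have m0 : 0 <= m by apply: Rintegral_ge0.
have sl3 : 0 < sigma * l3 by rewrite mulr_gt0.
near=> t.
have t0 : 0 < t by near: t; exact: nbhs_pinfty_gt.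
(* Since [expR (- lam * t) <= (lam * t)^-1], beyond this time the initial term is at most
   [sigma * l3 / lam], the same bound as for the source term. *)
have tm : m / (sigma * l3) < t by near: t; apply: nbhs_pinfty_gt; exact: num_real.
rewrite EE.
apply: le_trans (langevin_decay hF hB aw V2 V0 sigma0 l30 sl PL lapV cw wE' E0 t0) _.
rewrite lee_fin -/m -/lam mulr_natl mulr2n.
apply: lerD.
  have lt0 : 0 < lam * t by rewrite mulr_gt0.
  have e1 : expR (- lam * t) <= (lam * t)^-1.
    rewrite mulNr expRN lef_pV2 ?posrE ?expR_gt0//.
    by have := expR_ge1Dx (lam * t); lra.
  apply: le_trans (ler_wpM2r m0 e1) _.
  rewrite invfM -[leLHS]mulrA [leRHS]mulrC ler_wpM2l ?invr_ge0 ?(ltW lam0)//.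
  by rewrite mulrC ler_pdivrMr// mulrC -ler_pdivrMr// ltW.
rewrite ler_wpM2l ?(ltW sl3)// ler_piMl ?invr_ge0 ?(ltW lam0)//.
Unshelve. all: by end_near. Qed.
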